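(* Let $n,p,B\ge1$ be integers with $B$ dividing $n$, and consider the linear model $\mathbf{y}=\mathbf{X}\boldsymbol{\beta}_*+\boldsymbol{\eta}$ with $\mathbf{X}\in\mathbb{R}^{n\times p}$, feature covariance $\Sigma$ and noise variance $\sigma^2$. Let $\bar{\boldsymbol{\beta}}_k$ be the mean iterate after $k\ge0$ epochs of mini-batch gradient descent with random reshuffling, with $B$ mini-batches, step size $\alpha/B$ ($\alpha\ge0$) and initialization $\boldsymbol{\beta}_0\in\mathbb{R}^p$. Let $\mathbf{W}:=\frac1n\mathbf{X}^{\mathsf T}\mathbf{X}$. Suppose that $\Pi_b=\Pi:=\mathbf{I}-q(\mathbf{W})$ for each $b=1,\dots,B$, where $q\equiv q_\alpha$ is some polynomial, and that $\mathbf{X}$ and $\Pi$ are invertible. Let $\mathbf{X}=\mathbf{U}\mathbf{S}\mathbf{V}^{\mathsf T}$ be a singular value decomposition of $\mathbf{X}$, so that $\mathbf{W}=\mathbf{V}(\frac1n\mathbf{S}^{\mathsf T}\mathbf{S})\mathbf{V}^{\mathsf T}$, where $\frac1n\mathbf{S}^{\mathsf T}\mathbf{S}$ is a diagonal matrix with (non-zero) eigenvalues denoted by $\hat\lambda_1,\dots,\hat\lambda_p$. Then for $i=1,\dots,p$, the $i$th coordinate (in the eigenbasis $\mathbf{V}$) of the error vector $\bar{\boldsymbol{\beta}}_k-\boldsymbol{\beta}_*$ is given by $$[\mathbf{V}^{\mathsf T}(\bar{\boldsymbol{\beta}}_k-\boldsymbol{\beta}_* )]_i=\big[1-\alpha\hat\lambda_i(1-q(\hat\lambda_i))\big]^k[\mathbf{V}^{\mathsf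 T}(\boldsymbol{\beta}_0-\boldsymbol{\beta}_* )]_i+\frac{1}{\hat\lambda_i}\Big(1-\big[1-\alpha\hat\lambda_i(1-q(\hat\lambda_i))\big]^k\Big)[\mathbf{U}^{\mathsf T}\boldsymbol{\eta}]_i.$$ If, further, $\mathbf{V}^{\mathsf T}\Sigma\mathbf{V}=\Lambda$ is diagonal with eigenvalues $\lambda_1,\dots,\lambda_p$, then the corresponding generalization error is given by $$R_{\mathbf{X}}(\bar{\boldsymbol{\beta}}_k)=\sum_{i=1}^p\lambda_i\big[1-\alpha\hat\lambda_i(1-q(\hat\lambda_i))\big]^{2k}[\mathbf{V}^{\mathsf T}(\boldsymbol{\beta}_0-\boldsymbol{\beta}_* )]_i^2+\frac{\sigma^2}{n}\sum_{i=1}^p\frac{\lambda_i}{\hat\lambda_i}\Big(1-\big[1-\alpha\hat\lambda_i(1-q(\hat\lambda_i))\big]^k\Big)^2.$$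
   Context: Model: $(\mathbf{x}_i,y_i)$, $i=1,\dots,n$, are i.i.d. with $y_i=\mathbf{x}_i^{\mathsf T}\boldsymbol{\beta}_*+\eta_i$, $\boldsymbol{\beta}_*\in\mathbb{R}^p$ fixed, $\mathbb{E}[\mathbf{x}_i\mathbf{x}_i^{\mathsf T}]=\Sigma$, $\mathbb{E}[\eta_i\mid\mathbf{x}_i]=0$, $\mathbb{E}[\eta_i^2\mid\mathbf{x}_i]=\sigma^2$. $\mathbf{X}\in\mathbb{R}^{n\times p}$ has rows $\mathbf{x}_i^{\mathsf T}$, $\boldsymbol{\eta}=(\eta_1,\dots,\eta_n)^{\mathsf T}$. In the singular value decomposition, $\mathbf{U}\in\mathbb{R}^{n\times n}$ and $\mathbf{V}\in\mathbb{R}^{p\times p}$ are orthogonal and $\mathbf{S}\in\mathbb{R}^{n\times p}$ is diagonal. Generalization error: $R_{\mathbf{X}}(\boldsymbol{\beta}):=\mathbb{E}_{\mathbf{x},\boldsymbol{\eta}}[(\mathbf{x}^{\mathsf T}\boldsymbol{\beta}-\mathbf{x}^{\mathsf T}\boldsymbol{\beta}_* )^2\mid\mathbf{X}]=\mathbb{E}_{\boldsymbol{\eta}}[\|\boldsymbol{\beta}-\boldsymbol{\beta}_*\|_\Sigma^2\mid\mathbf{X}]$, where $\mathbf{x}$ is a newly sampled feature vector and $\|\mathbf{z}\|_\Sigma^2=\mathbf{z}^{\mathsf T}\Sigma\mathbf{z}$. Mini-batches: the rows of $\mathbf{X}$ are partitioned into $B$ groups of size $n/B$, giving $\mathbf{X}_1,\dots,\mathbf{X}_B$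 with corresponding subvectors $\mathbf{y}_b$ of $\mathbf{y}$; $\mathbf{W}_b:=\frac{B}{n}\mathbf{X}_b^{\mathsf T}\mathbf{X}_b$. Algorithm with step size $a=\alpha/B$: in each epoch $k=1,2,\dots$ a permutation $\tau$ is drawn uniformly at random from the set $S_B$ of permutations of $\{1,\dots,B\}$ (independently across epochs), and $$\boldsymbol{\beta}_k^{(b)}=\boldsymbol{\beta}_k^{(b-1)}-\frac{Ba}{n}\mathbf{X}_{\tau(b)}^{\mathsf T}\big(\mathbf{X}_{\tau(b)}\boldsymbol{\beta}_k^{(b-1)}-\mathbf{y}_{\tau(b)}\big),\quad b=1,\dots,B,$$ with $\boldsymbol{\beta}_k^{(0)}:=\boldsymbol{\beta}_{k-1}^{(B)}$, $\boldsymbol{\beta}_0^{(B)}:=\boldsymbol{\beta}_0$. The mean iterate is $\bar{\boldsymbol{\beta}}_k:=\mathbb{E}[\boldsymbol{\beta}_k^{(B)}]$, expectation over the permutations only. The matrices $\Pi_b$ (with step size $a=\alpha/B$) are $\Pi_b:=\frac{1}{B!}\sum_{\tau\in S_B}\prod_{j:\,j<\tau^{-1}(b)}(\mathbf{I}-a\mathbf{W}_{\tau(j)})$, factors multiplied from right to left in increasing order of $j$, empty product $=\mathbf{I}$.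
   Formalization: In the first formula the factor [U^T η]_i is corrected to [(1/n) S^T U^T η]_i; as printed it fails for n=p=B=1, X=2, q=0, k=1 (noise term 2αη, not ±αη). ''X invertible'' is read as full column rank. *)

(* Defs.v *)
From HB Require Import structures.
From mathcomp Require Import all_boot all_order all_algebra all_fingroup.
From mathcomp Require Import all_classical all_reals all_analysis.
From mathcomp Require Import measurable_realfun.

Set Implicit Arguments.
Unset Strict Implicit.
Unset Printing Implicit Defensive.
Import Order.TTheory GRing.Theory Num.Theory.

Local Open Scope classical_set_scope.
Local Open Scope ring_scope.

Section MiniBatch.
Context {R : realType} {n p B : nat}.

(* A split of the n rows into B batches of n / B rows: [rows b] lists the row
   indices of batch b, so that X_b is [rowsub (rows b) X] and y_b is
   [rowsub (rows b) y]. *)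
Definition batch_partition (rows : 'I_B -> 'I_(n %/ B) -> 'I_n) : Prop :=
  bijective (fun bi : 'I_B * 'I_(n %/ B) => rows bi.1 bi.2).

Variables (rows : 'I_B -> 'I_(n %/ B) -> 'I_n) (a : R) (X : 'M[R]_(n, p)).

Definition gram : 'M[R]_p := n%:R^-1 *: (X^T *m X).

Definition batch_gram (b : 'I_B) : 'M[R]_p :=
  (B%:R / n%:R) *: ((rowsub (rows b) X)^T *m rowsub (rows b) X).

(* [enum 'I_B] is increasing, so reversing it puts the factor of smallest
   index rightmost. *)
Definition Pi_mx (b : 'I_B) : 'M[R]_p :=
  (B`!)%:R^-1 *: \sum_(tau : 'S_B)
    \prod_(j <- rev (enum 'I_B) | (j < (tau^-1)%g b)%N)
      (1%:M - a *: batch_gram (tau j)).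

Variable y : 'cV[R]_n.

Definition batch_step (b : 'I_B) (beta : 'cV[R]_p) : 'cV[R]_p :=
  beta - (B%:R * a / n%:R) *:
    ((rowsub (rows b) X)^T *m (rowsub (rows b) X *m beta - rowsub (rows b) y)).

Definition epoch (beta : 'cV[R]_p) (tau : 'S_B) : 'cV[R]_p :=
  foldl (fun v b => batch_step (tau b) v) beta (enum 'I_B).

Definition iterate (beta0 : 'cV[R]_p) (taus : seq 'S_B) : 'cV[R]_p :=
  foldl epoch beta0 taus.

(* Independent uniform permutations in k epochs amount to a uniformly
   distributed k-tuple of permutations. *)
Definition mean_iterate (beta0 : 'cV[R]_p) (k : nat) : 'cV[R]_p :=
  (#|{: k.-tuple 'S_B}|)%:R^-1 *:
    \sum_(taus : k.-tuple 'S_B) iterate beta0 taus.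

End MiniBatch.

Definition orthogonal_mx (R : realType) (m : nat) (Q : 'M[R]_m) : Prop :=
  Q^T *m Q = 1%:M.

Definition is_svd (R : realType) (n p : nat) (X : 'M[R]_(n, p))
    (U : 'M[R]_n) (S : 'M[R]_(n, p)) (V : 'M[R]_p) : Prop :=
  [/\ orthogonal_mx U, orthogonal_mx V, is_diag_mx S & X = U *m S *m V^T].

Definition hat_lambda (R : realType) (n p : nat) (S : 'M[R]_(n, p))
  (i : 'I_p) : R := (n%:R^-1 *: (S^T *m S)) i i.

(* [row_full X] is left invertibility of the n x p matrix X, i.e. full column
   rank; it is the usual invertibility when n = p, and it holds exactly when
   the eigenvalues of [gram X] are all non-zero.  The dimension is p.+1 since
   [horner_mx] evaluates a polynomial only at matrices of positive size. *)
Record polynomial_reshuffling (R : realType) (n p B : nat)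
    (rows : 'I_B -> 'I_(n %/ B) -> 'I_n) (a : R) (X : 'M[R]_(n, p.+1))
    (q : {poly R}) (U : 'M[R]_n) (S : 'M[R]_(n, p.+1)) (V : 'M[R]_p.+1)
    : Prop := PolynomialReshuffling {
  X_invertible : row_full X;
  Pi_polynomial : forall b, Pi_mx rows a X b = 1%:M - horner_mx (gram X) q;
  Pi_invertible : 1%:M - horner_mx (gram X) q \in unitmx;
  svd : is_svd X U S V }.

Section Probability.
Local Open Scope ereal_scope.
Context d (T : measurableType d) (R : realType) (P : probability T R).

(* The product rule for every finite subfamily is the instance where the
   remaining events are the whole space. *)
Definition mutually_independent d' (T' : measurableType d') (I : finType)
    (Z : I -> T -> T') : Prop :=
  forall A : I -> set T', (forall i, measurable (A i)) ->
    P [set w | forall i, A i (Z i w)] = \prod_(i : I) P (Z i @^-1` A i).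

Definition independent d1 d2 (T1 : measurableType d1) (T2 : measurableType d2)
    (Z1 : T -> T1) (Z2 : T -> T2) : Prop :=
  forall A1 A2, measurable A1 -> measurable A2 ->
    P (Z1 @^-1` A1 `&` Z2 @^-1` A2) = P (Z1 @^-1` A1) * P (Z2 @^-1` A2).

Definition same_law d' (T' : measurableType d') (Z1 Z2 : T -> T') : Prop :=
  forall A, measurable A -> P (Z1 @^-1` A) = P (Z2 @^-1` A).

(* [h] is a version of z |-> E[Y | Z = z]; since every set of sigma(Z) is of
   the form Z^-1(A), this says that h(Z) is a version of E[Y | Z]. *)
Definition is_cond_expectation d' (T' : measurableType d')
    (Z : T -> T') (Y : T -> \bar R) (h : T' -> \bar R) : Prop :=
  [/\ measurable_fun setT Y,
      (forall w, 0 <= Y w) \/ P.-integrable setT Y,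
      measurable_fun setT h &
      forall A, measurable A ->
        \int[P]_(w in Z @^-1` A) Y w = \int[P]_(w in Z @^-1` A) h (Z w)].

End Probability.

Section LinearModel.
Context d (T : measurableType d) (R : realType) (P : probability T R).
Context (n p : nat).
Variables (x : 'I_n -> {RV P >-> p.-tuple R}) (y : 'I_n -> {RV P >-> R}).

Definition feature_vec (t : p.-tuple R) : 'cV[R]_p := \col_j tnth t j.

Definition design (w : T) : 'M[R]_(n, p) := \matrix_(i, j) tnth (x i w) j.

Definition response (w : T) : 'cV[R]_n := \col_i y i w.

Definition features (w : T) : n.-tuple (p.-tuple R) := [tuple x i w | i < n].

Definition sample (i : 'I_n) (w : T) : p.-tuple R * R := (x i w, y i w).

Variable betas : 'cV[R]_p.

Definition noise (w : T) : 'cV[R]_n := response w - design w *m betas.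

Record linear_model (Sigma : 'M[R]_p) (sigma : R) : Prop := LinearModel {
  samples_independent : mutually_independent P sample;
  samples_same_law : forall i j, same_law P (sample i) (sample j);
  (* a finite value of the integral forces integrability *)
  feature_covariance : forall i j l,
    ('E_P[fun w => (tnth (x i w) j * tnth (x i w) l)%R] = (Sigma j l)%:E)%E;
  noise_mean : forall i,
    is_cond_expectation P (x i) (fun w => (noise w i 0)%:E) (fun=> 0%E);
  noise_variance : forall i,
    is_cond_expectation P (x i) (fun w => (noise w i 0 ^+ 2)%:E)
      (fun=> (sigma ^+ 2)%:E) }.

Definition fresh_feature (x0 : {RV P >-> p.-tuple R}) : Prop :=
  independent P x0 (fun w => [tuple sample i w | i < n]) /\
  forall i, same_law P x0 (x i).

(* [risk] is a version of X |-> R_X(beta), the conditional expectation of the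
   squared prediction error at the new feature vector [x0] given X.  It is
   determined up to null sets of the law of X. *)
Definition is_generalization_error (x0 : {RV P >-> p.-tuple R})
    (beta : T -> 'cV[R]_p) (risk : n.-tuple (p.-tuple R) -> \bar R) : Prop :=
  is_cond_expectation P features
    (fun w => (((feature_vec (x0 w))^T *m beta w
                - (feature_vec (x0 w))^T *m betas) 0 0 ^+ 2)%:E)
    risk.

End LinearModel.

(* The law of the noise and of a new feature vector conditionally on one given
   value of the features: the noise variables are then independent, centered,
   of variance sigma^2, and the new feature vector is independent of them.
   This makes sense for every single matrix X, including those that form an
   event of probability zero. *)
Record conditional_model d (T : measurableType d) (R : realType)
    (P : probability T R) (n p : nat) (x0 : {RV P >-> p.-tuple R})
    (eta : 'I_n -> {RV P >-> R}) (Sigma : 'M[R]_p) (sigma : R)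
    : Prop := ConditionalModel {
  cond_noise_independent : mutually_independent P (fun i w => eta i w);
  cond_noise_mean : forall i, ('E_P[eta i] = 0)%E;
  cond_noise_variance : forall i,
    ('E_P[fun w => (eta i w ^+ 2)%R] = (sigma ^+ 2)%:E)%E;
  cond_fresh_independent : independent P x0 (fun w => [tuple eta i w | i < n]);
  cond_fresh_covariance : forall j l,
    ('E_P[fun w => (tnth (x0 w) j * tnth (x0 w) l)%R] = (Sigma j l)%:E)%E }.

(* Main.v *)
(* Write e for the error vector and W_b for the Gram matrix of batch b. A step
   moves the iterate by a multiple of a gradient which is affine in e, so an
   epoch maps e to
     e - a * sum_b (product of the later factors I - a W) * (gradient of b at e).
   Averaging over the permutations and reversing the order of the batches, the
   product becomes the transpose of Pi_b, which is the symmetric matrix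
   I - q(W). Since the batch gradients add up to B (W e - X^T eta / n), the mean
   error satisfies
     e' = e - alpha (I - q(W)) (W e - X^T eta / n),
   a recursion which the basis V diagonalizes and which is solved coordinate by
   coordinate.

   The error after k epochs is a linear combination, with coefficients depending
   on X only, of the constant 1 and the noise variables. Conditionally on X these
   are orthogonal with squared norms 1, sigma^2, ..., sigma^2, and the new
   feature vector is independent of them with second moments Sigma. This gives
   the conditional risk for every X, as a quadratic form which the singular
   value decomposition turns into the stated sum. *)

Require Import Defs.
From HB Require Import structures.
From mathcomp Require Import all_boot all_order all_algebra all_fingroup.
From mathcomp Require Import all_classical all_reals all_analysis.
From mathcomp Require Import measurable_realfun.
From mathcomp Require Import ring lra.

Set Implicit Arguments.
Unset Strict Implicit.
Unset Printing Implicit Defensive.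
Import Order.TTheory GRing.Theory Num.Theory.

Local Open Scope classical_set_scope.
Local Open Scope ring_scope.

(** * Mean epoch *)

Section BatchAlgebra.
Context {R : realType} {n p B : nat}.
Variables (rows : 'I_B -> 'I_(n %/ B) -> 'I_n) (a : R) (X : 'M[R]_(n, p)).

Lemma batch_stepD y1 y2 b v1 v2 :
  batch_step rows a X (y1 + y2) b (v1 + v2)
  = batch_step rows a X y1 b v1 + batch_step rows a X y2 b v2.
Proof.
rewrite /batch_step; have -> : rowsub (rows b) (y1 + y2)
  = rowsub (rows b) y1 + rowsub (rows b) y2 by apply/matrixP => i j; rewrite !mxE.
rewrite addrACA -opprD -scalerDr -mulmxDr; congr (_ - _ *: (_ *m _)).
by rewrite mulmxDr opprD addrACA.
Qed.

Lemma batch_stepZ c y b v :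
  batch_step rows a X (c *: y) b (c *: v) = c *: batch_step rows a X y b v.
Proof.
rewrite /batch_step; have -> : rowsub (rows b) (c *: y) = c *: rowsub (rows b) y
  by apply/matrixP => i j; rewrite !mxE.
by rewrite -scalemxAr -scalerBr -scalemxAr scalerBr !scalerA mulrC.
Qed.

Lemma batch_step_fixed b v : batch_step rows a X (X *m v) b v = v.
Proof.
rewrite /batch_step; have -> : rowsub (rows b) (X *m v) = rowsub (rows b) X *m v.
  by apply/matrixP => i j; rewrite !mxE; apply: eq_bigr => l _; rewrite mxE.
by rewrite subrr mulmx0 scaler0 subr0.
Qed.

Lemma epochD y1 y2 v1 v2 tau :
  epoch rows a X (y1 + y2) (v1 + v2) tau
  = epoch rows a X y1 v1 tau + epoch rows a X y2 v2 tau.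
Proof.
rewrite /epoch; elim: (enum _) v1 v2 => //= b s IH v1 v2.
by rewrite batch_stepD IH.
Qed.

Lemma epochZ c y v tau :
  epoch rows a X (c *: y) (c *: v) tau = c *: epoch rows a X y v tau.
Proof.
by rewrite /epoch; elim: (enum _) v => //= b s IH v; rewrite batch_stepZ IH.
Qed.

Lemma epoch_fixed v tau : epoch rows a X (X *m v) v tau = v.
Proof.
by rewrite /epoch; elim: (enum _) => //= b s IH; rewrite batch_step_fixed IH.
Qed.

Lemma mean_iterate0 y v : mean_iterate rows a X y v 0 = v.
Proof.
rewrite /mean_iterate (eq_bigr (fun=> v)); last by move=> taus _; rewrite tuple0.
by rewrite sumr_const -(scaler_nat _ v) scalerA card_tuple expn0 mulVf ?oner_eq0 ?scale1r.
Qed.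

(** A tuple of [k.+1] permutations is a head and a [k]-tuple, and the head drives the first epoch.
    Splitting off the first epoch changes the starting point, so inductions on [k] must quantify
    over it. *)
Lemma mean_iterateS y v k :
  mean_iterate rows a X y v k.+1
  = (B`!)%:R^-1 *: \sum_(tau : 'S_B)
      mean_iterate rows a X y (epoch rows a X y v tau) k.
Proof.
rewrite /mean_iterate -scaler_sumr scalerA; congr (_ *: _).
  by rewrite !card_tuple expnS natrM invfM card_Sn.
rewrite pair_big /=.
rewrite (reindex (fun t : 'S_B * k.-tuple 'S_B => [tuple of t.1 :: t.2])) //=.
exists (fun t : k.+1.-tuple 'S_B => (thead t, [tuple of behead t])) => [[t s]|t] _ /=.
  by rewrite theadE; congr (_, _); apply/val_inj.
by rewrite -tuple_eta.
Qed.

Lemma mean_iterateD y1 y2 v1 v2 k :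
  mean_iterate rows a X (y1 + y2) (v1 + v2) k
  = mean_iterate rows a X y1 v1 k + mean_iterate rows a X y2 v2 k.
Proof.
elim: k v1 v2 => [|k IH] v1 v2; first by rewrite !mean_iterate0.
rewrite !mean_iterateS -scalerDr -big_split /=; congr (_ *: _).
by apply: eq_bigr => tau _; rewrite epochD IH.
Qed.

Lemma mean_iterateZ c y v k :
  mean_iterate rows a X (c *: y) (c *: v) k = c *: mean_iterate rows a X y v k.
Proof.
elim: k v => [|k IH] v; first by rewrite !mean_iterate0.
rewrite !mean_iterateS scalerA mulrC -scalerA [in RHS]scaler_sumr; congr (_ *: _).
by apply: eq_bigr => tau _; rewrite epochZ IH.
Qed.

Lemma factB_neq0 : (B`!)%:R != 0 :> R.
Proof. by rewrite pnatr_eq0 -lt0n fact_gt0. Qed.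

Lemma mean_iterate_fixed v k : mean_iterate rows a X (X *m v) v k = v.
Proof.
elim: k => [|k IH]; first by rewrite mean_iterate0.
rewrite mean_iterateS (eq_bigr (fun=> v)) => [|tau _]; last by rewrite epoch_fixed.
by rewrite sumr_const card_Sn -(scaler_nat _ v) scalerA mulVf ?factB_neq0 ?scale1r.
Qed.

(** By joint linearity in response and starting point, the run splits in two: a noiseless run
    started at [v], where every batch residual vanishes and nothing moves, and a run on the noise
    alone started at the initial error. *)
Lemma mean_iterate_error v eta v0 k :
  mean_iterate rows a X (X *m v + eta) v0 k - v
  = mean_iterate rows a X eta (v0 - v) k.
Proof.
have {1}-> : v0 = v + (v0 - v) by rewrite addrC subrK.
by rewrite mean_iterateD mean_iterate_fixed addrC addKr.
Qed.

(** Gradient at [v] of the batch loss B/(2n) |X_b v - y_b|^2. *)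
Definition batch_gradient (y : 'cV[R]_n) b (v : 'cV[R]_p) : 'cV[R]_p :=
  (B%:R / n%:R) *:
    ((rowsub (rows b) X)^T *m (rowsub (rows b) X *m v - rowsub (rows b) y)).

Lemma batch_stepE y b v :
  batch_step rows a X y b v = v - a *: batch_gradient y b v.
Proof. by rewrite /batch_step /batch_gradient scalerA mulrCA mulrA. Qed.

Lemma batch_gram_sym b : (batch_gram rows X b)^T = batch_gram rows X b.
Proof. by rewrite /batch_gram linearZ /= trmx_mul trmxK. Qed.

Lemma batch_gradientE y b v :
  batch_gradient y b v
  = batch_gram rows X b *m v
    - (B%:R / n%:R) *: ((rowsub (rows b) X)^T *m rowsub (rows b) y).
Proof.
by rewrite /batch_gradient /batch_gram mulmxBr scalerBr -scalemxAl mulmxA.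
Qed.

Lemma batch_gradientB y b u v :
  batch_gradient y b (u - v)
  = batch_gradient y b u - batch_gram rows X b *m v.
Proof. by rewrite !batch_gradientE mulmxBr addrAC. Qed.

Let N b := 1%:M - a *: batch_gram rows X b.

Let N_sym b : (N b)^T = N b.
Proof.
by rewrite /N [LHS]linearB /= trmx1 [X in _ - X]linearZ /= batch_gram_sym.
Qed.

(* The gradients are all taken at the starting point [v]: a step moves its
   starting point by a multiple of the gradient, and the later steps transport
   this displacement linearly. *)
Lemma foldl_batch_step y (tau : 'I_B -> 'I_B) (s : seq 'I_B) v :
  sorted (fun i j : 'I_B => (i < j)%N) s ->
  foldl (fun w b => batch_step rows a X y (tau b) w) v s
  = v - a *: \sum_(i <- s) (\prod_(j <- rev s | (i < j)%N) N (tau j))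
                           *m batch_gradient y (tau i) v.
Proof.
have transp t u w : foldl (fun w b => batch_step rows a X y (tau b) w) (u - w) t
  = foldl (fun w b => batch_step rows a X y (tau b) w) u t
    - (\prod_(j <- rev t) N (tau j)) *m w.
  elim: t u w => [|b t IH] u w /=; first by rewrite big_nil mul1mx.
  rewrite rev_cons big_rcons /= -mulmxA -IH; congr foldl.
  rewrite !batch_stepE batch_gradientB scalerBr mulmxBl mul1mx.
  rewrite -(scalemxAl a) -!addrA !opprB; congr (_ + _).
  by rewrite [RHS]addrC addrA [- w + _]addrC.
elim: s v => [|b s IH] v /=; first by rewrite big_nil scaler0 subr0.
(* Sortedness puts the head [b] below every index of [s]: the displacement made at [b] is
   transported by the whole tail, and [b] contributes no factor to the products of the later
   indices. *)
rewrite (path_sortedE (fun _ _ _ => @ltn_trans _ _ _)) => /andP[/allP bs /IH {}IH].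
rewrite batch_stepE transp IH big_cons -addrA -opprD -scalemxAr -scalerDr.
congr (_ - _ *: _); rewrite addrC rev_cons; congr (_ *m _ + _).
  rewrite big_rcons /= ltnn mulr1 -[LHS]big_filter -[RHS]big_filter.
  congr (\big[_/_]_(_ <- _) _); apply: eq_in_filter => j.
  by rewrite mem_rev => /bs ->.
apply: eq_big_seq => i /bs bi; congr (_ *m _).
by rewrite big_rcons /= ltnNge ltnW // mulr1.
Qed.

Lemma tr_prodmx (I : Type) (r : seq I) (Q : pred I) (F : I -> 'M[R]_p) :
  (\prod_(i <- r | Q i) F i)^T = \prod_(i <- rev r | Q i) (F i)^T.
Proof.
elim: r => [|i r IH]; first by rewrite !big_nil trmx1.
rewrite big_cons rev_cons big_rcons /= -IH.
by case: ifP => _; rewrite ?mulr1 // trmx_mul.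
Qed.

Lemma sorted_enum_ord : sorted (fun i j : 'I_B => (i < j)%N) (enum 'I_B).
Proof. by have := iota_ltn_sorted 0 B; rewrite -val_enum_ord sorted_map. Qed.

Lemma rev_enum_ord : rev (enum 'I_B) = map (@rev_ord B) (enum 'I_B).
Proof.
apply: (inj_map val_inj); rewrite map_rev val_enum_ord -[RHS]map_comp.
apply: (@eq_from_nth _ 0%N) => [|i]; rewrite size_rev size_iota.
  by rewrite size_map size_enum_ord.
move=> iB; rewrite nth_rev ?size_iota // (nth_map (Ordinal iB)) ?size_enum_ord //.
by rewrite /= nth_enum_ord // nth_iota // subnSK // leq_subr.
Qed.

(* Reversing the order of the batches turns the product over the batches that
   come after [b] into the transpose of the product over those that come
   before [b]. *)
Lemma sum_epoch y v :
  \sum_(tau : 'S_B) epoch rows a X y v tau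
  = (B`!)%:R *: (v - a *: \sum_b (Pi_mx rows a X b)^T *m batch_gradient y b v).
Proof.
pose F (tau : 'S_B) (b : 'I_B) :=
  (\prod_(j <- rev (enum 'I_B) | (j < (tau^-1)%g b)%N) N (tau j))^T
    *m batch_gradient y b v.
(* In a product of permutations the left factor acts first, so [revp * tau] visits the batches of
   [tau] in reverse order. Left multiplication by [revp] is a bijection of ['S_B] and does not
   change the sum. *)
pose revp : 'S_B := perm (@rev_ord_inj B).
have step tau : epoch rows a X y v (revp * tau)%g = v - a *: \sum_b F tau b.
  rewrite /epoch (foldl_batch_step y (fun j => (revp * tau)%g j)); last first.
    exact: sorted_enum_ord.
  congr (_ - _ *: _); rewrite big_enum /= [RHS](reindex_inj (@perm_inj _ tau)) /=.
  rewrite [RHS](reindex_inj (@rev_ord_inj B)) /=; apply: eq_bigr => i _.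
  rewrite /F permK permM permE; congr (_ *m _).
  rewrite tr_prodmx revK rev_enum_ord big_map.
  apply: eq_big => j.
    by rewrite /= !ltn_subRL !addSn addnC.
  move=> _; rewrite permM permE /= rev_ordK; apply/esym/N_sym.
rewrite (reindex_inj (mulgI revp)) /= (eq_bigr _ (fun tau _ => step tau)).
rewrite big_split /= sumr_const card_Sn -(scaler_nat _ v) scalerBr sumrN -scaler_sumr.
congr (_ - _); rewrite scalerA mulrC -scalerA; congr (_ *: _).
rewrite exchange_big scaler_sumr /=; apply: eq_bigr => b _.
rewrite /F -mulmx_suml /Pi_mx [X in _ = _ *: (X *m _)]linearZ /= -scalemxAl scalerA.
by rewrite mulfV ?factB_neq0 // scale1r linear_sum.
Qed.

End BatchAlgebra.

(** * Coordinates in the singular basis *)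

(** Each row index is hit by exactly one pair of a batch and a position, so the sum over rows can be
    reindexed by such pairs. *)
Lemma sum_rowsub_batches (R : realType) (n p m B : nat)
    (rows : 'I_B -> 'I_(n %/ B) -> 'I_n) (X : 'M[R]_(n, p)) (z : 'M[R]_(n, m)) :
  batch_partition rows ->
  \sum_b (rowsub (rows b) X)^T *m rowsub (rows b) z = X^T *m z.
Proof.
move=> rowsP; apply/matrixP => i j; rewrite summxE !mxE.
rewrite (reindex (fun bi : 'I_B * 'I_(n %/ B) => rows bi.1 bi.2)) /=; last first.
  exact: onW_bij.
rewrite -(pair_bigA _ (fun b l => X^T i (rows b l) * z (rows b l) j)) /=.
by apply: eq_bigr => b _; rewrite !mxE; apply: eq_bigr => l _; rewrite !mxE.
Qed.

Section Coordinates.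
Context {R : realType} {n p' B : nat}.
Let p := p'.+1.
Hypotheses (n_gt0 : (0 < n)%N) (B_gt0 : (0 < B)%N).
Variables (rows : 'I_B -> 'I_(n %/ B) -> 'I_n) (alpha : R).
Hypothesis rowsP : batch_partition rows.
Variables (X : 'M[R]_(n, p)) (q : {poly R}).
Variables (U : 'M[R]_n) (S : 'M[R]_(n, p)) (V : 'M[R]_p).
Hypothesis XP : polynomial_reshuffling rows (alpha / B%:R) X q U S V.

Let nR_neq0 : n%:R != 0 :> R. Proof. by rewrite pnatr_eq0 -lt0n. Qed.
Let BR_neq0 : B%:R != 0 :> R. Proof. by rewrite pnatr_eq0 -lt0n. Qed.

Let VtV : V^T *m V = 1%:M. Proof. by case: XP => _ _ _ []. Qed.
Let VVt : V *m V^T = 1%:M. Proof. exact: mulmx1C. Qed.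
Let XE : X = U *m S *m V^T. Proof. by case: XP => _ _ _ []. Qed.
Let UtU : U^T *m U = 1%:M. Proof. by case: XP => _ _ _ []. Qed.

Definition hat_lambda_row : 'rV[R]_p := \row_i hat_lambda S i.

Lemma hat_lambdaE i : hat_lambda S i = n%:R^-1 * \sum_j S j i ^+ 2.
Proof.
by rewrite /hat_lambda !mxE; congr (_ * _); apply: eq_bigr => j _; rewrite !mxE.
Qed.

Lemma scaled_trmx_mul_diag :
  is_diag_mx S -> n%:R^-1 *: (S^T *m S) = diag_mx hat_lambda_row.
Proof.
move=> /is_diag_mxP Sdiag; apply/matrixP => i j; rewrite [in RHS]mxE mxE.
have [->|ij] := eqVneq i j; first by rewrite mulr1n [in RHS]mxE /hat_lambda [RHS]mxE.
rewrite mulr0n mxE big1 ?mulr0 // => k _; rewrite mxE.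
(* [S] is rectangular, so its row and column indices live in different ordinal types and are
   compared as numbers. *)
have [ki|ki] := eqVneq (k : nat) (i : nat); last by rewrite Sdiag ?mul0r.
by rewrite (Sdiag k j) ?mulr0 // ki.
Qed.

Lemma gram_svd : gram X = V *m diag_mx hat_lambda_row *m V^T.
Proof.
have Sdiag : is_diag_mx S by case: XP => _ _ _ [].
rewrite -scaled_trmx_mul_diag // /gram XE !trmx_mul trmxK.
rewrite -scalemxAr -scalemxAl !mulmxA; congr (_ *: (_ *m _)).
by rewrite -(mulmxA (V *m S^T)) UtU mulmx1.
Qed.

Lemma horner_gram r :
  horner_mx (gram X) r = V *m diag_mx (map_mx (horner r) hat_lambda_row) *m V^T.
Proof.
have VU : V \in unitmx by case/mulmx1_unit: VVt.
have VI : invmx V = V^T by rewrite -[LHS]mulmx1 -VVt mulKmx.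
by rewrite gram_svd -VI horner_mx_uconj // horner_mx_diag.
Qed.

Lemma tr_horner_gram r : (horner_mx (gram X) r)^T = horner_mx (gram X) r.
Proof. by rewrite horner_gram !trmx_mul trmxK tr_diag_mx mulmxA. Qed.

(** If the eigenvalue were zero, column [i] of [S] would vanish, hence also that of
    [X *m V = U *m S]. A left inverse of [X] would then kill column [i] of the orthogonal matrix
    [V]. *)
Lemma hat_lambda_neq0 i : hat_lambda S i != 0.
Proof.
rewrite hat_lambdaE mulf_neq0 ?invr_eq0 //; apply: contraTneq isT => /eqP.
rewrite psumr_eq0 => [|j _]; last exact: sqr_ge0.
move=> /allP S0; have {}S0 j : S j i = 0.
  by apply/eqP; rewrite -sqrf_eq0; apply: S0; rewrite mem_index_enum.
have [C CX] : exists C, C *m X = 1%:M by apply/row_fullP; case: XP.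
have : col i (C *m X *m V) = 0.
  rewrite XE -mulmxA -(mulmxA _ V^T) VtV mulmx1 mulmxA colE -mulmxA -colE.
  rewrite (_ : col i S = 0) ?mulmx0 //.
  by apply/matrixP => j l; rewrite !mxE S0.
rewrite CX mul1mx => /(congr1 (mulmx V^T)); rewrite mulmx0 colE mulmxA VtV mul1mx.
by move=> /matrixP/(_ i 0); rewrite !mxE !eqxx => /eqP; rewrite oner_eq0.
Qed.

(** Coordinate [i], in the basis [V], of the noise term X^T eta / n, because V^T X^T = S^T U^T. *)
Let s eta i : R := (n%:R^-1 *: (S^T *m (U^T *m eta)) : 'cV_p) i 0.
Let l := hat_lambda S.
Let decay i := 1 - alpha * l i * (1 - q.[l i]).

(** Since all the [Pi_mx] equal one symmetric polynomial in the Gram matrix, this factor leaves the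
    sum over batches. The batch gradients add up to [B] times the full gradient, and that [B]
    cancels the one in the step size. *)
Lemma mean_epoch eta v :
  (B`!)%:R^-1 *: \sum_(tau : 'S_B) epoch rows (alpha / B%:R) X eta v tau
  = v - alpha *: ((1%:M - horner_mx (gram X) q)
                  *m (gram X *m v - n%:R^-1 *: (X^T *m eta))).
Proof.
rewrite sum_epoch scalerA mulVf ?factB_neq0 // scale1r; congr (_ - _).
case: XP => _ PiE _ _.
under eq_bigr => b _ do rewrite PiE [X in X *m _]linearB /= trmx1 tr_horner_gram.
rewrite -mulmx_sumr.
have -> : \sum_b batch_gradient rows X eta b v
    = B%:R *: (gram X *m v - n%:R^-1 *: (X^T *m eta)).
  rewrite /batch_gradient -scaler_sumr.
  have rowE b : rowsub (rows b) X *m v - rowsub (rows b) eta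
      = rowsub (rows b) (X *m v - eta).
    apply/matrixP => i j; rewrite !mxE; congr (_ - _).
    by apply: eq_bigr => k _; rewrite mxE.
  under eq_bigr => b _ do rewrite rowE.
  rewrite sum_rowsub_batches // mulmxBr mulmxA /gram -scalemxAl -scalerBr.
  by rewrite scalerA.
by rewrite -scalemxAr scalerA divfK.
Qed.

Lemma mean_epoch_coordinate eta v i :
  (V^T *m ((B`!)%:R^-1 *:
     \sum_(tau : 'S_B) epoch rows (alpha / B%:R) X eta v tau)) i 0
  = decay i * (V^T *m v) i 0 + alpha * (1 - q.[l i]) * s eta i.
Proof.
have PiV : V^T *m (1%:M - horner_mx (gram X) q)
    = diag_mx (\row_i (1 - q.[l i])) *m V^T.
  rewrite mulmxBr mulmx1 horner_gram !mulmxA VtV mul1mx -[X in X - _]mul1mx.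
  rewrite -mulmxBl; congr (_ *m _); apply/matrixP => a b; rewrite !mxE.
  by case: eqVneq => [->|]; rewrite ?mulr1n ?mulr0n ?subr0.
have gramV : V^T *m gram X = diag_mx hat_lambda_row *m V^T.
  by rewrite gram_svd !mulmxA VtV mul1mx.
rewrite mean_epoch mulmxBr -scalemxAr mulmxA PiV -mulmxA mulmxBr -scalemxAr.
rewrite !mulmxA gramV [V^T *m X^T](_ : _ = S^T *m U^T); last first.
  by rewrite XE !trmx_mul trmxK !mulmxA VtV mul1mx.
rewrite -!mulmxA /s; move: (V^T *m v) (n%:R^-1 *: _) => u w.
rewrite !mul_diag_mx !mxE /decay -/(l i); ring.
Qed.

(** One mean epoch acts on coordinate [i] as the scalar affine map u -> decay u + (1 - decay) s / l,
    with fixed point s / l. The claimed value is affine in the start [v], so averaging it over the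
    first permutation only involves the mean after one epoch. *)
Lemma mean_iterate_coordinate eta v k i :
  (V^T *m mean_iterate rows (alpha / B%:R) X eta v k) i 0
  = decay i ^+ k * (V^T *m v) i 0 + (l i)^-1 * (1 - decay i ^+ k) * s eta i.
Proof.
elim: k v => [|k IH] v.
  by rewrite mean_iterate0 expr0 mul1r subrr mulr0 mul0r addr0.
have l0 := hat_lambda_neq0 i.
rewrite mean_iterateS -scalemxAr mulmx_sumr mxE summxE.
under eq_bigr => tau _ do rewrite IH.
rewrite big_split /= sumr_const card_Sn mulrDr -[X in _ + _ * X]mulr_natl mulKf ?factB_neq0 //.
rewrite -mulr_sumr mulrCA.
have -> : (B`!)%:R^-1 * \sum_(tau : 'S_B)
    (V^T *m epoch rows (alpha / B%:R) X eta v tau) i 0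
  = decay i * (V^T *m v) i 0 + alpha * (1 - q.[l i]) * s eta i.
  by rewrite -mean_epoch_coordinate -scalemxAr mulmx_sumr mxE summxE.
have -> : alpha * (1 - q.[l i]) = (l i)^-1 * (1 - decay i).
  by rewrite /decay -/(l i) /l; field.
rewrite exprS; ring.
Qed.

End Coordinates.

(** * Decomposition of the error into initial error and noise modes *)

Lemma sum_option (V : zmodType) (n : nat) (F : option 'I_n -> V) :
  \sum_o F o = F None + \sum_i F (Some i).
Proof.
rewrite (bigD1 None) //=; congr (_ + _).
rewrite (reindex_omap (@Some 'I_n) id) /=; last by case.
by apply: eq_bigl => i; rewrite eqxx.
Qed.

Section ErrorDecomposition.
Context {R : realType} {n p B : nat}.
Variables (rows : 'I_B -> 'I_(n %/ B) -> 'I_n) (a : R).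
Variables (e0 : 'cV[R]_p) (k : nat).

(* The error is jointly linear in the initial error and the noise: index
   [None] stands for the former, and [Some i] for the i-th noise variable. *)
Definition error_mode (X : 'M[R]_(n, p)) (o : option 'I_n) : 'cV[R]_p :=
  if o is Some i then mean_iterate rows a X (delta_mx i 0) 0 k
  else mean_iterate rows a X 0 e0 k.

Definition error_coef (eta : 'I_n -> R) (o : option 'I_n) : R :=
  if o is Some i then eta i else 1.

Lemma mean_iterate_modes X (eta : 'cV[R]_n) :
  mean_iterate rows a X eta e0 k
  = \sum_o error_coef (fun i => eta i 0) o *: error_mode X o.
Proof.
rewrite sum_option /= scale1r -{1}[eta]add0r -{1}[e0]addr0 mean_iterateD.
congr (_ + _); have {1}-> : eta = \sum_i eta i 0 *: delta_mx i 0.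
  by rewrite [LHS]matrix_sum_delta; apply: eq_bigr => i _; rewrite big_ord1.
elim/big_rec2: _ => [|i y1 y2 _ <-].
  (* Homogeneity with factor zero shows that the run with zero response and zero start stays at
     zero. *)
  rewrite -[0 in LHS](scale0r (0 : 'cV[R]_n)).
  rewrite -[X in mean_iterate _ _ _ _ X](scale0r (0 : 'cV[R]_p)).
  by rewrite mean_iterateZ scale0r.
by rewrite -[X in mean_iterate _ _ _ _ X]addr0 mean_iterateD
  -[X in mean_iterate _ _ _ (_ *: _) X](scaler0 _ (eta i 0)) mean_iterateZ.
Qed.

(** The weights 1 and sigma^2 are the second moments of the coefficients of the modes; there are no
    cross terms because these coefficients are orthogonal given [X]. The expression makes sense for
    every [X], with no assumption on the reshuffling matrices. *)
Definition conditional_risk (Sigma : 'M[R]_p) (sigma : R) (X : 'M[R]_(n, p)) : R :=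
  \sum_o error_coef (fun=> sigma ^+ 2) o
         * ((error_mode X o)^T *m Sigma *m error_mode X o) 0 0.

End ErrorDecomposition.

(** In the basis [V] the quadratic form of Sigma is a weighted sum of squared coordinates. The mode
    [None] has zero noise and yields the first sum; the modes [Some j] have zero initial error and
    together yield the second. *)
Lemma conditional_risk_polynomial (R : realType) (n p' B : nat)
    (rows : 'I_B -> 'I_(n %/ B) -> 'I_n) (alpha : R) (X : 'M[R]_(n, p'.+1))
    q U S V (Sigma : 'M[R]_p'.+1) (sigma : R) (e0 : 'cV[R]_p'.+1) (k : nat) :
  (0 < n)%N -> (0 < B)%N -> batch_partition rows ->
  polynomial_reshuffling rows (alpha / B%:R) X q U S V ->
  is_diag_mx (V^T *m Sigma *m V) ->
  let l := hat_lambda S in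
  let decay i := 1 - alpha * l i * (1 - q.[l i]) in
  conditional_risk rows (alpha / B%:R) e0 k Sigma sigma X
  = \sum_i (V^T *m Sigma *m V) i i * decay i ^+ (2 * k) * (V^T *m e0) i 0 ^+ 2
    + sigma ^+ 2 / n%:R
      * \sum_i (V^T *m Sigma *m V) i i / l i * (1 - decay i ^+ k) ^+ 2.
Proof.
move=> n_gt0 B_gt0 rowsP XP Ldiag l decay; set L := V^T *m Sigma *m V.
have nR_neq0 : n%:R != 0 :> R by rewrite pnatr_eq0 -lt0n.
have [UtU VtV Sdiag XE] := svd XP.
have VVt : V *m V^T = 1%:M by exact: mulmx1C.
have quadE (e : 'cV[R]_p'.+1) :
    (e^T *m Sigma *m e) 0 0 = \sum_i L i i * (V^T *m e) i 0 ^+ 2.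
  have -> : e^T *m Sigma *m e = (V^T *m e)^T *m (L *m (V^T *m e)).
    rewrite /L trmx_mul trmxK !mulmxA -(mulmxA e^T V) VVt mulmx1.
    by rewrite -(mulmxA (e^T *m Sigma)) VVt mulmx1.
  rewrite mxE; apply: eq_bigr => i _; rewrite mxE mulrC [X in X * _]mxE.
  rewrite (bigD1 i) //= big1 ?addr0 => [|j ji]; first by rewrite -mulrA -expr2.
  by move/is_diag_mxP: Ldiag => ->; rewrite ?mul0r // eq_sym.
rewrite /conditional_risk sum_option /= mul1r !quadE; congr (_ + _).
  apply: eq_bigr => i _; rewrite (mean_iterate_coordinate n_gt0 B_gt0 rowsP XP) -/l -/(decay i).
  rewrite !mulmx0 scaler0 [(0 : 'cV__) i 0]mxE mulr0 addr0 exprMn mulrA.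
  by rewrite mulnC exprM.
rewrite -mulr_sumr -mulrA; congr (_ * _).
rewrite (eq_bigr _ (fun j _ => quadE _)).
rewrite exchange_big mulr_sumr /=; apply: eq_bigr => i _.
have l0 : l i != 0 by exact: hat_lambda_neq0 XP i.
transitivity (L i i * ((l i)^-1 * (1 - decay i ^+ k)) ^+ 2 * (n%:R^-1 * l i)); last first.
  by field; rewrite l0 nR_neq0.
(* Row [i] of [S^T *m U^T] has squared norm (S^T S)_ii = n l_i, as [U] is orthogonal. *)
have -> : n%:R^-1 * l i = \sum_j (n%:R^-1 * (S^T *m U^T) i j) ^+ 2.
  under eq_bigr => j _ do rewrite exprMn.
  rewrite -mulr_sumr /l hat_lambdaE expr2 -mulrA; congr (_ * (_ * _)).
  transitivity ((S^T *m U^T *m (U *m S)) i i).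
    rewrite mulmxA -(mulmxA S^T) UtU mulmx1 mxE.
    by apply: eq_bigr => j _; rewrite mxE.
  by rewrite mxE; apply: eq_bigr => j _; rewrite -[U *m S]trmxK trmx_mul [X in _ * X]mxE.
rewrite mulr_sumr; apply: eq_bigr => j _.
rewrite (mean_iterate_coordinate n_gt0 B_gt0 rowsP XP) -/l -/(decay i).
rewrite mulmx0 [(0 : 'cV__) i 0]mxE mulr0 add0r.
rewrite mulmxA -colE -[RHS]mulrA -exprMn; congr (_ * (_ * _) ^+ 2).
by rewrite [LHS]mxE [X in _ * X]mxE.
Qed.

(** * Integrals of products of independent variables *)

Section RealIntegral.
Local Open Scope ereal_scope.
Context d (T : measurableType d) (R : realType) (P : probability T R).
Implicit Types f g : T -> R.

Lemma eq_real_integrable f g : f =1 g ->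
  P.-integrable setT (EFin \o f) -> P.-integrable setT (EFin \o g).
Proof. by move=> /funext ->. Qed.

Lemma measurable_real_integrable f :
  P.-integrable setT (EFin \o f) -> measurable_fun setT f.
Proof. by case/integrableP => /measurable_EFinP. Qed.

Lemma le_real_integrable f g : measurable_fun setT f ->
  (forall w, `|f w| <= `|g w|)%R ->
  P.-integrable setT (EFin \o g) -> P.-integrable setT (EFin \o f).
Proof.
move=> mf fg; apply: le_integrable => //; first exact/measurable_EFinP.
by move=> w _; rewrite /= lee_fin.
Qed.

Lemma real_integrableD f g :
  P.-integrable setT (EFin \o f) -> P.-integrable setT (EFin \o g) ->
  P.-integrable setT (EFin \o (fun w => f w + g w)%R).
Proof. by move=> fi gi; apply: eq_integrable (integrableD _ fi gi). Qed.

Lemma real_integrableZ c f : P.-integrable setT (EFin \o f) ->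
  P.-integrable setT (EFin \o (fun w => c * f w)%R).
Proof. by move=> fi; apply: eq_integrable (integrableZl _ c fi). Qed.

Lemma real_integrable_cst c : P.-integrable setT (EFin \o (fun=> c)).
Proof. exact: finite_measure_integrable_cst. Qed.

Lemma real_integrable_sum I (s : seq I) (F : I -> T -> R) :
  (forall i, P.-integrable setT (EFin \o F i)) ->
  P.-integrable setT (EFin \o (fun w => \sum_(i <- s) F i w)%R).
Proof.
move=> Fi; elim: s => [|i s IH].
  apply: eq_real_integrable (real_integrable_cst 0) => w.
  by rewrite big_nil.
by apply: eq_real_integrable (real_integrableD (Fi i) IH) => w; rewrite big_cons.
Qed.

Lemma real_integrable_indicM (A : set T) f : measurable A ->
  P.-integrable setT (EFin \o f) ->
  P.-integrable setT (EFin \o (fun w => \1_A w * f w)%R).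
Proof.
move=> mA fi; apply: (le_real_integrable _ _ fi) => [|w].
  by apply: measurable_funM => //; exact: measurable_real_integrable.
rewrite normrM ler_piMl //; rewrite indicE.
by case: (_ \in _); rewrite ?normr1 ?normr0.
Qed.

Lemma real_integralD f g :
  P.-integrable setT (EFin \o f) -> P.-integrable setT (EFin \o g) ->
  \int[P]_w (f w + g w)%:E = \int[P]_w (f w)%:E + \int[P]_w (g w)%:E.
Proof. by move=> fi gi; rewrite -integralD. Qed.

Lemma real_integralZ c f : P.-integrable setT (EFin \o f) ->
  \int[P]_w (c * f w)%:E = c%:E * \int[P]_w (f w)%:E.
Proof. by move=> fi; rewrite -integralZl. Qed.

Lemma real_integral_cst c : \int[P]_w (c%:E) = c%:E.
Proof. by rewrite integral_cst //= probability_setT mule1. Qed.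

Lemma real_integral_sum I (s : seq I) (F : I -> T -> R) :
  (forall i, P.-integrable setT (EFin \o F i)) ->
  \int[P]_w (\sum_(i <- s) F i w)%:E = \sum_(i <- s) \int[P]_w (F i w)%:E.
Proof.
move=> Fi; elim: s => [|i s IH].
  by under eq_integral do rewrite big_nil; rewrite integral0 big_nil.
under eq_integral do rewrite big_cons.
by rewrite real_integralD //; [rewrite IH big_cons|exact: real_integrable_sum].
Qed.

Lemma real_integral_fin f : P.-integrable setT (EFin \o f) ->
  (fine (\int[P]_w (f w)%:E))%:E = \int[P]_w (f w)%:E.
Proof. by move=> fi; rewrite fineK //; exact: integrable_fin_num fi. Qed.

Lemma real_integral_indicM (A : set T) f : measurable A ->
  \int[P]_w (\1_A w * f w)%:E = \int[P]_(w in A) (f w)%:E.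
Proof.
move=> mA; rewrite [RHS]integral_mkcond; apply: eq_integral => w _.
by rewrite epatch_indic EFinM muleC.
Qed.

(** Domination through |f g| <= f^2 + g^2. *)
Lemma real_integrableM f g :
  measurable_fun setT f -> measurable_fun setT g ->
  P.-integrable setT (EFin \o (fun w => f w ^+ 2)%R) ->
  P.-integrable setT (EFin \o (fun w => g w ^+ 2)%R) ->
  P.-integrable setT (EFin \o (fun w => f w * g w)%R).
Proof.
move=> mf mg fi gi; apply: (le_real_integrable _ _ (real_integrableD fi gi)).
  exact: measurable_funM.
move=> w; rewrite [leRHS]ger0_norm ?addr_ge0 ?sqr_ge0 // normrM.
rewrite -(real_normK (num_real (f w))) -(real_normK (num_real (g w))).
move: (normr_ge0 (f w)) (normr_ge0 (g w)).
by move: `|f w|%R `|g w|%R => u v u0 v0; nra.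
Qed.

End RealIntegral.

(** * Weighting integrals by functions of a random element *)

Section WeightedIntegral.
Local Open Scope ereal_scope.
Context d d1 (T : measurableType d) (T1 : measurableType d1) (R : realType).
Variables (P : probability T R) (X : T -> T1).
Hypothesis mX : measurable_fun setT X.

Lemma measurable_preimage_setT (A : set T1) : measurable A -> measurable (X @^-1` A).
Proof. by move=> mA; rewrite -[_ @^-1` _]setTI; exact: mX. Qed.

Import HBNNSimple.

(** The assumption covers indicator weights. Linearity extends it to simple weights, and monotone
    convergence along simple approximations of [m] to all nonnegative ones. *)
Lemma ge0_integral_weight (f g : T -> R) (m : T1 -> \bar R) :
  measurable_fun setT f -> measurable_fun setT g -> measurable_fun setT m ->
  (forall w, 0 <= f w)%R -> (forall w, 0 <= g w)%R -> (forall t, 0 <= m t) ->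
  (forall A, measurable A ->
    \int[P]_w (\1_(X @^-1` A) w * f w)%:E
    = \int[P]_w (\1_(X @^-1` A) w * g w)%:E) ->
  \int[P]_w (m (X w) * (f w)%:E) = \int[P]_w (m (X w) * (g w)%:E).
Proof.
move=> mf mg mm f0 g0 m0 fg; pose h := nnsfun_approx measurableT mm.
have mhX k : measurable_fun setT (fun w => (h k (X w))%:E).
  by apply/measurable_EFinP; exact: measurableT_comp.
have limE (u : T -> R) : measurable_fun setT u -> (forall w, 0 <= u w)%R ->
    \int[P]_w (m (X w) * (u w)%:E)
    = limn (fun k => \int[P]_w ((h k (X w))%:E * (u w)%:E)).
  move=> mu u0; rewrite -monotone_convergence //=.
  - apply: eq_integral => w _; apply/esym/cvg_lim => //.
    by apply: cvgeZr => //; apply: cvg_nnsfun_approx => // t _; exact: m0.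
  - by move=> k; apply: emeasurable_funM => //; exact/measurable_EFinP.
  - by move=> k w _; rewrite mule_ge0 // lee_fin.
  - move=> w _ i j ij; apply: lee_wpmul2r; first by rewrite lee_fin.
    by rewrite lee_fin; exact/lefP/nd_nnsfun_approx.
have simpleE (u : T -> R) k : measurable_fun setT u -> (forall w, 0 <= u w)%R ->
    \int[P]_w ((h k (X w))%:E * (u w)%:E)
    = \sum_(r \in range (h k))
        (r%:E * \int[P]_(w in X @^-1` (h k @^-1` [set r])) (u w)%:E).
  move=> mu u0.
  have indE r w : (r * \1_(h k @^-1` [set r]) (X w))%:E * (u w)%:E
      = r%:E * ((EFin \o u) \_ (X @^-1` (h k @^-1` [set r]))) w.
    by rewrite epatch_indic EFinM -muleA; congr (_ * _); rewrite muleC.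
  under eq_integral => w _.
    rewrite fimfunE -fsumEFin // ge0_mule_fsuml; last first.
      by move=> r; rewrite EFinM nnfun_muleindic_ge0.
    over.
  have mpre r : measurable (X @^-1` (h k @^-1` [set r])).
    by apply: measurable_preimage_setT; exact: measurable_sfunP.
  rewrite ge0_integral_fsum //; last 2 first.
  - move=> r; apply: emeasurable_funM => //; apply/measurable_EFinP => //.
    by apply: measurable_funM => //; apply: measurableT_comp.
  - move=> r w _; apply: mule_ge0; last by rewrite lee_fin.
    by rewrite EFinM nnfun_muleindic_ge0.
  apply: eq_fsbigr => r /set_mem [t _ <-].
  under eq_integral => w _ do rewrite indE.
  rewrite ge0_integralZl_EFin //.
  - by rewrite -integral_mkcond.
  - by move=> w _; rewrite epatch_indic mule_ge0 //= lee_fin.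
  - by apply/(measurable_restrictT _ _).1 => //; exact/measurable_funTS/measurable_EFinP.
rewrite !limE //; congr (limn _); apply/funext => k; rewrite !simpleE //.
apply: eq_fsbigr => r _; congr (_ * _).
have mr : measurable (h k @^-1` [set r]) by exact: measurable_sfunP.
have mXr := measurable_preimage_setT mr.
by rewrite -(real_integral_indicM P f mXr) fg // real_integral_indicM.
Qed.

(** The assumption says that the positive and negative parts of [f] have the same integral over
    every event of [X], so [ge0_integral_weight] equates their integrals under any nonnegative
    weight. Splitting [m] by sign as well finishes the argument. *)
Lemma integral_weight_eq0 (f : T -> R) (m : T1 -> R) :
  P.-integrable setT (EFin \o f) -> measurable_fun setT m ->
  (forall A, measurable A -> \int[P]_w (\1_(X @^-1` A) w * f w)%:E = 0) ->
  P.-integrable setT (EFin \o (fun w => m (X w) * f w)%R) ->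
  \int[P]_w (m (X w) * f w)%:E = 0.
Proof.
move=> fi mm f0 mfi.
have mf := measurable_real_integrable fi.
have mp := measurable_funrpos mf; have mn := measurable_funrneg mf.
have fpi := integrable_funrpos measurableT fi.
have fni := integrable_funrneg measurableT fi.
have fE w : (f^\+ w - f^\- w)%R = f w by rewrite -[in RHS](funrposBneg f).
have pn (h : T1 -> R) : measurable_fun setT h -> (forall t, 0 <= h t)%R ->
    \int[P]_w (h (X w) * f^\+ w)%:E = \int[P]_w (h (X w) * f^\- w)%:E.
  move=> mh h0; apply: (ge0_integral_weight (m := EFin \o h)) => //.
  - exact/measurable_EFinP.
  move=> A mA; have mXA := measurable_preimage_setT mA.
  have pI := real_integrable_indicM mXA fpi.
  have nI := real_integrable_indicM mXA fni.
  rewrite -(real_integral_fin pI) -(real_integral_fin nI).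
  apply: congr1; apply/eqP; rewrite -subr_eq0 -eqe EFinB !real_integral_fin //.
  rewrite -[X in X == _]integralB //; apply/eqP/(etrans _ (f0 A mA)).
  by apply: eq_integral => w _; rewrite -EFinB -mulrBr fE.
(* Each product of a part of [m] with a part of [f] is dominated by [m (X w) * f w], so no
   difference below is of the form oo - oo. *)
have dom (h : T1 -> R) (u : T -> R) : measurable_fun setT h -> measurable_fun setT u ->
    (forall t, `|h t| <= `|m t|)%R -> (forall w, `|u w| <= `|f w|)%R ->
    P.-integrable setT (EFin \o (fun w => h (X w) * u w)%R).
  move=> mh mu hm uf; apply: (le_real_integrable _ _ mfi) => [|w].
    by apply: measurable_funM => //; exact: measurableT_comp.
  by rewrite !normrM ler_pM.
have le_pos (S : Type) (u : S -> R) s : (`|u^\+ s| <= `|u s|)%R.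
  by rewrite ger0_norm ?funrpos_ge0 // /funrpos ge_max ler_norm normr_ge0.
have le_neg (S : Type) (u : S -> R) s : (`|u^\- s| <= `|u s|)%R.
  by rewrite ger0_norm ?funrneg_ge0 // /funrneg ge_max -normrN ler_norm normr_ge0.
have mmp := measurable_funrpos mm; have mmn := measurable_funrneg mm.
have part (h : T1 -> R) : measurable_fun setT h -> (forall t, 0 <= h t)%R ->
    (forall t, `|h t| <= `|m t|)%R -> \int[P]_w (h (X w) * f w)%:E = 0.
  move=> mh h0 hm; have Ip := dom h _ mh mp hm (le_pos _ f).
  have In := dom h _ mh mn hm (le_neg _ f).
  transitivity (\int[P]_w ((h (X w) * f^\+ w)%:E - (h (X w) * f^\- w)%:E)).
    by apply: eq_integral => w _; rewrite -EFinB -mulrBr fE.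
  rewrite integralB // pn // subee //; exact: integrable_fin_num In.
transitivity (\int[P]_w ((m^\+ (X w) * f w)%:E - (m^\- (X w) * f w)%:E)).
  by apply: eq_integral => w _; rewrite -EFinB -mulrBl -[in LHS](funrposBneg m).
rewrite integralB //; [|exact: dom|exact: dom].
by rewrite !part ?sube0.
Qed.

(** Centering: [\1_E - P E] integrates to zero over every event of [X], hence also against the
    weight [f]. *)
Lemma indep_event_integral (E : set T) (f : T1 -> R) :
  measurable E -> measurable_fun setT f ->
  (forall A, measurable A -> P (X @^-1` A `&` E) = P (X @^-1` A) * P E) ->
  P.-integrable setT (EFin \o (f \o X)) ->
  \int[P]_w (\1_E w * f (X w))%:E = P E * \int[P]_w (f (X w))%:E.
Proof.
move=> mE mf indep fi; set c := fine (P E).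
have cE : c%:E = P E by rewrite fineK // fin_num_measure.
have indicE_int (A : set T) : measurable A -> \int[P]_w (\1_A w)%:E = P A.
  by move=> mA; rewrite integral_indic // setIT.
have iE : P.-integrable setT (EFin \o (\1_E : T -> R)) by exact: integrable_indic.
have ixi : P.-integrable setT (EFin \o (fun w => \1_E w + - c)%R).
  exact: real_integrableD iE (real_integrable_cst _ _).
have f1 : P.-integrable setT (EFin \o (fun w => \1_E w * f (X w))%R).
  exact: real_integrable_indicM.
have f2 := real_integrableZ (- c) fi.
have /eqP : \int[P]_w (f (X w) * (\1_E w + - c))%:E = 0.
  apply: integral_weight_eq0 => //.
    move=> A mA; have mXA := measurable_preimage_setT mA.
    transitivity (\int[P]_w (\1_(X @^-1` A `&` E) w + (- c) * \1_(X @^-1` A) w)%:E).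
      by apply: eq_integral => w _; rewrite indicI /= mulrDr [X in (_ + X)%R]mulrC.
    rewrite real_integralD; last 2 first.
    - by apply: integrable_indic => //; exact: measurableI.
    - by apply: real_integrableZ; exact: integrable_indic.
    rewrite real_integralZ; last exact: integrable_indic.
    rewrite !indicE_int //; last exact: measurableI.
    by rewrite indep // EFinN mulNe cE muleC subee // fin_numM // fin_num_measure.
  by apply: eq_real_integrable (real_integrableD f1 f2) => w /=; rewrite mulrDr
    mulrC [X in (_ + X)%R]mulrC.
have -> : \int[P]_w (f (X w) * (\1_E w + - c))%:E
   = \int[P]_w (\1_E w * f (X w) + (- c) * f (X w))%:E.
  by apply: eq_integral => w _; rewrite mulrDr mulrC [X in (_ + X)%R]mulrC.
rewrite real_integralD // real_integralZ // -(real_integral_fin f1).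
rewrite -(real_integral_fin fi) -cE -!EFinM -EFinD eqe mulNr subr_eq0 => /eqP ->.
by [].
Qed.

End WeightedIntegral.

Section IndependentProduct.
Local Open Scope ereal_scope.
Context d d1 d2 (T : measurableType d) (T1 : measurableType d1)
  (T2 : measurableType d2) (R : realType).
Variables (P : probability T R) (X : T -> T1) (Y : T -> T2).
Hypotheses (mX : measurable_fun setT X) (mY : measurable_fun setT Y).
Hypothesis XY : independent P X Y.

(** The centered variable f(X) - E f(X) integrates to zero over every event of [Y], hence against
    the weight [g]. Integrability of the product comes first: under the weight |g(Y)|, the variable
    |f(X)| may be replaced by its finite mean. *)
Lemma indep_product_integral (f : T1 -> R) (g : T2 -> R) :
  measurable_fun setT f -> measurable_fun setT g ->
  P.-integrable setT (EFin \o (f \o X)) ->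
  P.-integrable setT (EFin \o (g \o Y)) ->
  P.-integrable setT (EFin \o (fun w => f (X w) * g (Y w))%R) /\
  \int[P]_w (f (X w) * g (Y w))%:E
  = \int[P]_w (f (X w))%:E * \int[P]_w (g (Y w))%:E.
Proof.
move=> mf mg fi gi.
have mfX : measurable_fun setT (fun w => f (X w)) by exact: measurableT_comp.
have mgY : measurable_fun setT (fun w => g (Y w)) by exact: measurableT_comp.
have ev (h : T1 -> R) (A : set T2) : measurable_fun setT h -> measurable A ->
    P.-integrable setT (EFin \o (h \o X)) ->
    \int[P]_w (\1_(Y @^-1` A) w * h (X w))%:E
    = P (Y @^-1` A) * \int[P]_w (h (X w))%:E.
  move=> mh mA hi; apply: indep_event_integral => //.
  - exact: measurable_preimage_setT.
  - by move=> A1 mA1; exact: XY.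
have indic_int (A : set T2) : measurable A ->
    \int[P]_w (\1_(Y @^-1` A) w)%:E = P (Y @^-1` A).
  by move=> mA; rewrite integral_indic ?setIT //; exact: measurable_preimage_setT.
have fgi : P.-integrable setT (EFin \o (fun w => f (X w) * g (Y w))%R).
  apply/integrableP; split; first by apply/measurable_EFinP; exact: measurable_funM.
  have afi : P.-integrable setT (EFin \o (Num.norm \o f \o X)).
    exact: integrable_norm fi.
  set c := fine (\int[P]_w (`|f (X w)|%:E)).
  have c0 : (0 <= c)%R by apply: fine_ge0; apply: integral_ge0 => w _; rewrite lee_fin.
  under eq_integral => w _ do rewrite /= normrM mulrC EFinM.
  rewrite (@ge0_integral_weight _ _ _ _ _ P Y mY (fun w => `|f (X w)|)%R (fun=> c)
    (fun t => `|g t|%:E)) //.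
  - under eq_integral => w _ do rewrite muleC.
    rewrite integralZl //; last exact: integrable_norm gi.
    by rewrite lte_mul_pinfty //; case/integrableP: gi.
  - exact: measurableT_comp.
  - by apply/measurable_EFinP; exact: measurableT_comp.
  - move=> A mA; rewrite (ev (Num.norm \o f)) //; last exact: measurableT_comp.
    under [RHS]eq_integral => w _ do rewrite mulrC.
    rewrite real_integralZ; last by apply: integrable_indic; exact: measurable_preimage_setT.
    by rewrite indic_int // muleC -(real_integral_fin afi).
split=> //; set c := fine (\int[P]_w (f (X w))%:E).
have ixi := real_integrableD fi (real_integrable_cst P (- c)%R).
have f2 := real_integrableZ (- c) gi.
have : \int[P]_w (g (Y w) * (f (X w) + - c))%:E = 0.
  apply: (integral_weight_eq0 mY) => //.
    move=> A mA; have mYA := measurable_preimage_setT mY mA.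
    have i1 := real_integrable_indicM mYA fi.
    have i2 : P.-integrable setT (EFin \o (\1_(Y @^-1` A) : T -> R)).
      exact: integrable_indic.
    transitivity (\int[P]_w (\1_(Y @^-1` A) w * f (X w)
                             + (- c) * \1_(Y @^-1` A) w)%:E).
      by apply: eq_integral => w _; rewrite mulrDr [X in (_ + X)%R]mulrC.
    rewrite real_integralD //; last exact: real_integrableZ.
    rewrite real_integralZ // ev // indic_int // -(real_integral_fin fi) -/c.
    by rewrite EFinN mulNe muleC subee // fin_numM // fin_num_measure.
  by apply: eq_real_integrable (real_integrableD fgi f2) => w /=; rewrite mulrDr
    [X in (X + _)%R]mulrC [X in (_ + X)%R]mulrC.
have -> : \int[P]_w (g (Y w) * (f (X w) + - c))%:E
    = \int[P]_w (f (X w) * g (Y w) + (- c) * g (Y w))%:E.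
  by apply: eq_integral => w _; rewrite mulrDr [X in (X + _)%R]mulrC [X in (_ + X)%R]mulrC.
rewrite real_integralD // real_integralZ // -(real_integral_fin fgi).
rewrite -(real_integral_fin fi) -(real_integral_fin gi) -!EFinM -EFinD => /eqP.
by rewrite eqe mulNr subr_eq0 => /eqP ->.
Qed.

End IndependentProduct.

(** * Rectangles as generators of the tuple sigma-algebra *)

Section TupleRectangles.
Context d (T : measurableType d) (n : nat).

Definition tuple_rectangles : set (set (n.-tuple T)) :=
  [set A | exists2 A_ : 'I_n -> set T, (forall i, measurable (A_ i)) &
     A = [set t | forall i, A_ i (tnth t i)]].

Lemma tuple_rectangles_setI : setI_closed tuple_rectangles.
Proof.
move=> _ _ [A mA ->] [B mB ->]; exists (fun i => A i `&` B i).
  by move=> i; exact: measurableI.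
apply/seteqP; split=> [t [tA tB] i|t tAB]; first by split.
by split=> i; case: (tAB i).
Qed.

Lemma measurable_tuple_rectangle A : tuple_rectangles A -> measurable A.
Proof.
move=> [A_ mA ->].
rewrite (_ : [set t | _] = \bigcap_(i in [set: 'I_n]) (fun t => tnth t i) @^-1` A_ i).
  apply: fin_bigcap_measurable => // i _.
  rewrite -[X in measurable X]setTI; exact: (measurable_tnth i).
by apply/seteqP; split=> [t tA i _|t tA i]; exact: tA.
Qed.

(** The generating coordinate preimages are rectangles with all but one side full, and rectangles
    are finite intersections of such preimages. *)
Lemma measurable_tupleE :
  @measurable _ (n.-tuple T) = <<s tuple_rectangles >>.
Proof.
apply/seteqP; split; last first.
  apply: smallest_sub; first exact: sigma_algebra_measurable.
  exact: measurable_tuple_rectangle.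
apply: smallest_sub; first exact: smallest_sigma_algebra.
rewrite -bigcup_seq => _ [i _ [B mB <-]]; apply: sub_sigma_algebra.
exists (fun j => if j == i then B else setT).
  by move=> j; case: ifP.
rewrite setTI; apply/seteqP; split=> [t /= tB j|t /= /(_ i)]; last by rewrite eqxx.
by case: eqP => [->|].
Qed.

End TupleRectangles.

Section RectangleInduction.
Local Open Scope ereal_scope.
Context d d1 (T : measurableType d) (T1 : measurableType d1) (R : realType).
Variables (P : probability T R) (n : nat) (F : T -> n.-tuple T1).
Hypothesis mF : measurable_fun setT F.

(** Dynkin's argument: rectangles are closed under intersection, and the sets on whose preimage [f]
    integrates to zero are closed under complement and countable disjoint union. *)
Lemma integral_tuple_eq0 (f : T -> R) :
  P.-integrable setT (EFin \o f) ->
  (forall A_ : 'I_n -> set T1, (forall i, measurable (A_ i)) ->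
    \int[P]_w (\1_[set w | forall i, A_ i (tnth (F w) i)] w * f w)%:E = 0) ->
  forall A, measurable A -> \int[P]_w (\1_(F @^-1` A) w * f w)%:E = 0.
Proof.
move=> fi f0 A; rewrite measurable_tupleE.
have mpre := measurable_preimage_setT mF.
have fT : \int[P]_w (f w)%:E = 0.
  rewrite -(f0 (fun=> setT)) //; apply: eq_integral => w _.
  by rewrite indicE mem_set ?mul1r.
apply: (dynkin_induction
    (P := fun A => \int[P]_w (\1_(F @^-1` A) w * f w)%:E = 0)).
- exact: measurable_tupleE.
- exact: tuple_rectangles_setI.
- by rewrite -fT; apply: eq_integral => w _; rewrite indicE mem_set ?mul1r.
- by move=> _ [A_ mA ->]; exact: f0.
- move=> S mS S0.
  transitivity (\int[P]_w (f w + (- 1) * (\1_(F @^-1` S) w * f w))%:E).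
    apply: eq_integral => w _; congr EFin; rewrite preimage_setC indicC indicE.
    by case: (w \in _) => /=; ring.
  have Si := real_integrable_indicM (mpre _ mS) fi.
  rewrite real_integralD // ?real_integralZ ?fT ?S0 ?mule0 ?adde0 //.
  exact: real_integrableZ.
- move=> S mS tS S0.
  have mFS k : measurable (F @^-1` S k) by exact: mpre.
  rewrite real_integral_indicM; last by apply: mpre; exact: bigcupT_measurable.
  rewrite preimage_bigcup integral_bigcup //.
  + by rewrite eseries0 // => k _ _; rewrite -real_integral_indicM.
  + by apply/trivIsetP => i j _ _ ij; rewrite -preimage_setI; move/trivIsetP: tS => ->.
  + by apply: (integrableS measurableT) => //; exact: bigcupT_measurable.
Qed.

End RectangleInduction.

(** * Second moments of the noise given the features *)

Section NoiseCovariance.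
Local Open Scope ereal_scope.
Context d d1 d2 (T : measurableType d) (T1 : measurableType d1)
  (T2 : measurableType d2) (R : realType) (P : probability T R) (n : nat).
(** [phi] extracts the features and [psi] the noise from a sample [Z i]. This covers both the linear
    model, where a sample is a pair of features and response, and a fixed design, where the sample
    is the noise and [phi] is constant. *)
Variables (Z : 'I_n -> T -> T1) (phi : 'I_n -> T1 -> T2) (psi : 'I_n -> T1 -> R).
Variable sigma : R.
Hypothesis mZ : forall i, measurable_fun setT (Z i).
Hypothesis mphi : forall i, measurable_fun setT (phi i).
Hypothesis mpsi : forall i, measurable_fun setT (psi i).
Hypothesis Zindep : mutually_independent P Z.
Hypothesis psi_sqr : forall i,
  P.-integrable setT (EFin \o (fun w => psi i (Z i w) ^+ 2)%R).
Hypothesis psi_mean : forall i A, measurable A ->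
  \int[P]_w (\1_A (phi i (Z i w)) * psi i (Z i w))%:E = 0.
Hypothesis psi_var : forall i A, measurable A ->
  \int[P]_w (\1_A (phi i (Z i w)) * psi i (Z i w) ^+ 2)%:E
  = \int[P]_w (\1_A (phi i (Z i w)) * sigma ^+ 2)%:E.

Let others (a : 'I_n) (C : 'I_n -> set T1) : set T :=
  [set w | forall i, i != a -> C i (Z i w)].

Let rect (C : 'I_n -> set T1) : set T := [set w | forall i, C i (Z i w)].

Let measurable_rect C : (forall i, measurable (C i)) -> measurable (rect C).
Proof.
move=> mC; rewrite /rect.
rewrite (_ : [set w | _] = \bigcap_(i in [set: 'I_n]) Z i @^-1` C i).
  by apply: fin_bigcap_measurable => // i _; exact: measurable_preimage_setT.
by apply/seteqP; split=> [w wC i _|w wC i]; exact: wC.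
Qed.

Let othersE a C : others a C = rect (fun i => if i == a then setT else C i).
Proof.
apply/seteqP; split=> w wC i; first by case: eqVneq => // /wC.
by move=> /negbTE ia; have := wC i; rewrite ia.
Qed.

(** Both events are rectangles in the samples, with side [A] or the full space at index [a]; the
    product rule applied to each leaves the same factors at the other indices. *)
Let indep_others a C A : (forall i, measurable (C i)) -> measurable A ->
  P (Z a @^-1` A `&` others a C) = P (Z a @^-1` A) * P (others a C).
Proof.
move=> mC mA; rewrite othersE /rect.
have -> : Z a @^-1` A `&` [set w | forall i, (if i == a then setT else C i) (Z i w)]
    = [set w | forall i, (if i == a then A else C i) (Z i w)].
  apply/seteqP; split=> [w [wA wC] i|w wC].
    by have := wC i; case: eqP => [->|].
  split=> [|i]; first by have := wC a; rewrite eqxx.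
  by have := wC i; case: eqP.
rewrite (Zindep (A := fun i => if i == a then A else C i)); last first.
  by move=> i; case: ifP.
rewrite (Zindep (A := fun i => if i == a then setT else C i)); last first.
  by move=> i; case: ifP.
rewrite (bigD1 a) //= eqxx [in RHS](bigD1 a) //= eqxx preimage_setT.
rewrite probability_setT mul1e; congr (_ * _).
by apply: eq_bigr => i /negbTE ->.
Qed.

Let integral_others a C (f : T1 -> R) : (forall i, measurable (C i)) ->
  measurable_fun setT f -> P.-integrable setT (EFin \o (f \o Z a)) ->
  \int[P]_w (f (Z a w))%:E = 0 ->
  \int[P]_w (\1_(others a C) w * f (Z a w))%:E = 0.
Proof.
move=> mC mf fi f0; rewrite (indep_event_integral (mZ a)) ?f0 ?mule0 //.
  by rewrite othersE; apply: measurable_rect => i; case: ifP.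
by move=> A mA; exact: indep_others.
Qed.

Let zeta o w := error_coef (fun i => psi i (Z i w)) o.

Let mpsiZ i : measurable_fun setT (fun w => psi i (Z i w)).
Proof. exact: measurableT_comp. Qed.

Lemma measurable_error_coef o : measurable_fun setT (zeta o).
Proof. by case: o => [i|] /=; [exact: mpsiZ|exact: measurable_cst]. Qed.

Lemma integrable_error_coef_sqr o :
  P.-integrable setT (EFin \o (fun w => zeta o w ^+ 2)%R).
Proof. by case: o => [i|] //=; exact: real_integrable_cst. Qed.

Lemma integrable_error_coefM o1 o2 :
  P.-integrable setT (EFin \o (fun w => zeta o1 w * zeta o2 w)%R).
Proof.
by apply: real_integrableM; [exact: measurable_error_coef
  |exact: measurable_error_coef|exact: integrable_error_coef_sqr
  |exact: integrable_error_coef_sqr].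
Qed.

Definition error_cov (o1 o2 : option 'I_n) : R :=
  if o1 == o2 then error_coef (fun=> sigma ^+ 2)%R o1 else 0%R.

Let feat w := [tuple phi i (Z i w) | i < n].

Lemma measurable_feat : measurable_fun setT feat.
Proof.
apply/measurable_fun_tnthP => i.
rewrite (_ : _ \o _ = phi i \o Z i); first exact: measurableT_comp.
by apply/funext => w /=; rewrite tnth_mktuple.
Qed.

(** A rectangle of features is a condition on sample [a] times a condition on the other samples,
    which are independent of it. So equal noise indices reduce to the conditional variance, and a
    noise variable paired with another one or with 1 reduces to its conditional mean. *)
Let integral_rect_eq0 o1 o2 (A : 'I_n -> set T2) : (forall i, measurable (A i)) ->
  \int[P]_w (\1_[set w | forall i, A i (tnth (feat w) i)] w
             * (zeta o1 w * zeta o2 w - error_cov o1 o2))%:E = 0.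
Proof.
move=> mA; pose C i := phi i @^-1` A i.
have mC i : measurable (C i) by exact: measurable_preimage_setT.
have rectE : [set w | forall i, A i (tnth (feat w) i)] = rect C.
  by apply/seteqP; split=> w wA i; have := wA i; rewrite tnth_mktuple.
rewrite {}rectE.
have rect_others a w : \1_(rect C) w
    = (\1_(others a C) w * \1_(A a) (phi a (Z a w)))%R :> R.
  rewrite !indicE -natrM mulnb; congr (_%:R); congr nat_of_bool.
  apply/idP/andP => [/set_mem wC|[/set_mem wC /set_mem wA]].
    by split; apply/mem_set; [move=> i _; exact: wC|exact: (wC a)].
  by apply/mem_set => i; have [->|/wC] := eqVneq i a.
have mindic i (B : set T2) : measurable B ->
    measurable_fun setT (fun z => \1_B (phi i z) : R).
  move=> mB; have mB1 : measurable_fun setT (\1_B : T2 -> R) by exact: measurable_indic.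
  exact: (measurableT_comp mB1 (mphi i)).
have ipsi i : P.-integrable setT (EFin \o (fun w => psi i (Z i w))).
  have := integrable_error_coefM (Some i) None.
  by apply: eq_real_integrable => w; rewrite /zeta /= mulr1.
have iindic i (g : T1 -> R) : P.-integrable setT (EFin \o (g \o Z i)) ->
    P.-integrable setT (EFin \o ((fun z => \1_(A i) (phi i z) * g z)%R \o Z i)).
  move=> gi; have mAi : measurable (Z i @^-1` C i) by exact: measurable_preimage_setT.
  exact: eq_real_integrable (real_integrable_indicM mAi gi).
have one a : \int[P]_w (\1_(rect C) w * psi a (Z a w))%:E = 0.
  under eq_integral => w _ do rewrite (rect_others a) -mulrA.
  apply: (integral_others (f := fun z => \1_(A a) (phi a z) * psi a z)%R) => //.
  - by apply: measurable_funM => //; exact: mindic.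
  - exact: (iindic a (psi a) (ipsi a)).
  - exact: psi_mean.
case: o1 o2 => [a|] [b|].
- have [<-{b}|ab] := eqVneq a b.
    rewrite /error_cov eqxx /=.
    under eq_integral => w _ do rewrite (rect_others a) -mulrA -expr2.
    have i2 : P.-integrable setT (EFin \o (fun w => psi a (Z a w) ^+ 2 - sigma ^+ 2)%R).
      exact: real_integrableD (psi_sqr a) (real_integrable_cst _ _).
    apply: (integral_others
      (f := fun z => \1_(A a) (phi a z) * (psi a z ^+ 2 - sigma ^+ 2))%R) => //.
    + apply: measurable_funM; first exact: mindic.
      by apply: measurable_funB => //; exact: measurable_funX.
    + exact: (iindic a (fun z => psi a z ^+ 2 - sigma ^+ 2)%R i2).
    + have i1 := iindic a (fun z => psi a z ^+ 2)%R (psi_sqr a).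
      have i3 := iindic a (fun=> sigma ^+ 2)%R (real_integrable_cst P (sigma ^+ 2)).
      under eq_integral => w _ do rewrite mulrBr EFinB.
      rewrite integralB // psi_var // subee //; exact: integrable_fin_num i3.
  have -> : error_cov (Some a) (Some b) = 0%R.
    by rewrite /error_cov; case: eqP => // -[] /eqP; rewrite (negbTE ab).
  (* [f] collects what does not depend on sample [b]; it integrates to zero on
     every event in terms of sample [b], since psi_a has mean zero. *)
  pose C' i := if i == b then setT else C i.
  have mC' i : measurable (C' i) by rewrite /C'; case: ifP.
  pose f w := (\1_(others a C') w * (\1_(A a) (phi a (Z a w)) * psi a (Z a w)))%R.
  pose m z := (\1_(A b) (phi b z) * psi b z)%R.
  have fmE w : (m (Z b w) * f w
      = \1_(rect C) w * (zeta (Some a) w * zeta (Some b) w - 0))%R.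
    rewrite (rect_others a) subr0 /m /f /zeta /=.
    suff -> : \1_(others a C) w
        = (\1_(A b) (phi b (Z b w)) * \1_(others a C') w)%R :> R by ring.
    rewrite !indicE -natrM mulnb; congr (_%:R); congr nat_of_bool.
    apply/idP/andP => [/set_mem wC|[/set_mem wB /set_mem wC]].
      split; apply/mem_set; first by apply: wC; rewrite eq_sym.
      by move=> i ia; rewrite /C'; case: ifP => // _; exact: wC.
    apply/mem_set => i ia; have := wC i ia; rewrite /C'.
    by case: eqP => // ->.
  under eq_integral => w _ do rewrite -fmE.
  have mo : measurable (others a C').
    by rewrite othersE; apply: measurable_rect => i; case: ifP.
  have fi : P.-integrable setT (EFin \o f).
    by apply: real_integrable_indicM => //; exact: (iindic a (psi a) (ipsi a)).
  apply: (integral_weight_eq0 (mZ b)) => //.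
  + by apply: measurable_funM => //; exact: mindic.
  (* Intersecting with an event [D] of sample [b] only fills the side at [b], left full in [C'], so
     [integral_others] applies again. *)
  + move=> D mD; pose C2 i := if i == b then D else C i.
    have mC2 i : measurable (C2 i) by rewrite /C2; case: ifP.
    rewrite -[RHS](@integral_others a C2
      (fun z => \1_(A a) (phi a z) * psi a z)%R) //; last first.
    * exact: psi_mean.
    * exact: (iindic a (psi a) (ipsi a)).
    * by apply: measurable_funM => //; exact: mindic.
    apply: eq_integral => w _; rewrite /f mulrA; congr ((_ * _)%:E).
    rewrite !indicE -natrM mulnb; congr (_%:R); congr nat_of_bool.
    apply/andP/idP => [[/set_mem wB /set_mem wC]|/set_mem wC].
      apply/mem_set => i ia; have := wC i ia; rewrite /C' /C2.
      by case: eqP => // ->.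
    split; apply/mem_set.
      by have := wC b; rewrite /C2 eqxx eq_sym; apply.
    by move=> i ia; have := wC i ia; rewrite /C' /C2; case: eqP.
  + apply: (eq_real_integrable (fun w => esym (fmE w))).
    apply: real_integrable_indicM; first exact: measurable_rect.
    apply: eq_real_integrable (integrable_error_coefM (Some a) (Some b)) => w.
    by rewrite subr0.
- rewrite /error_cov /zeta /=; under eq_integral => w _ do rewrite mulr1 subr0.
  exact: one.
- rewrite /error_cov /zeta /=; under eq_integral => w _ do rewrite mul1r subr0.
  exact: one.
- rewrite /error_cov /zeta /=; under eq_integral => w _ do rewrite mul1r subrr mulr0.
  exact: integral0.
Qed.

Lemma error_coef_cov o1 o2 A : measurable A ->
  \int[P]_w (\1_(feat @^-1` A) w
             * (zeta o1 w * zeta o2 w - error_cov o1 o2))%:E = 0.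
Proof.
apply: integral_tuple_eq0; first exact: measurable_feat.
  exact: real_integrableD (integrable_error_coefM o1 o2) (real_integrable_cst _ _).
by move=> A_ mA; exact: integral_rect_eq0.
Qed.

End NoiseCovariance.

(** * Conditional risk *)

Section MeasurableIterate.
Context d (T : measurableType d) (R : realType) (n p B : nat).
Variables (rows : 'I_B -> 'I_(n %/ B) -> 'I_n) (a : R).
Variables (X : T -> 'M[R]_(n, p)) (y : T -> 'cV[R]_n).
Hypothesis mX : forall i j, measurable_fun setT (fun t => X t i j).
Hypothesis my : forall i, measurable_fun setT (fun t => y t i 0%R).

Let mcol (v : T -> 'cV[R]_p) := forall i, measurable_fun setT (fun t => v t i 0%R).

Lemma measurable_batch_step v b : mcol v -> mcol (fun t => batch_step rows a (X t) (y t) b (v t)).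
Proof.
move=> mv i.
rewrite (_ : (fun t => _) = fun t => (v t i 0 - (B%:R * a / n%:R) *
   \sum_r X t (rows b r) i * (\sum_l X t (rows b r) l * v t l 0 - y t (rows b r) 0))%R).
  apply: measurable_funB => //; apply: measurable_funM => //.
  apply: measurable_sum => r; apply: measurable_funM => //.
  apply: measurable_funB => //; apply: measurable_sum => l.
  exact: measurable_funM.
apply/funext => t; rewrite !mxE; congr (_ - _ * _)%R.
apply: eq_bigr => r _; rewrite !mxE; congr (_ * (_ - _))%R.
by apply: eq_bigr => l _; rewrite mxE.
Qed.

Lemma measurable_epoch v tau : mcol v -> mcol (fun t => epoch rows a (X t) (y t) (v t) tau).
Proof.
rewrite /epoch; elim: (enum _) v => //= b s IH v mv.
by apply: IH; exact: measurable_batch_step.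
Qed.

Lemma measurable_mean_iterate v k :
  mcol v -> mcol (fun t => mean_iterate rows a (X t) (y t) (v t) k).
Proof.
elim: k v => [|k IH] v mv i.
  by rewrite (_ : (fun t => _) = fun t => v t i 0) //; apply/funext => t; rewrite mean_iterate0.
rewrite (_ : (fun t => _) = fun t => ((B`!)%:R^-1 * \sum_(tau : 'S_B)
  mean_iterate rows a (X t) (y t) (epoch rows a (X t) (y t) (v t) tau) k i 0)%R).
  apply: measurable_funM => //; apply: measurable_sum => tau.
  by apply: IH; exact: measurable_epoch.
by apply/funext => t; rewrite mean_iterateS mxE summxE.
Qed.

End MeasurableIterate.

Definition features_mx (R : realType) (n p : nat) (t : n.-tuple (p.-tuple R)) : 'M[R]_(n, p) :=
  \matrix_(i, j) tnth (tnth t i) j.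

Lemma measurable_features_mx (R : realType) (n p : nat) i j :
  measurable_fun setT (fun t : n.-tuple (p.-tuple R) => features_mx t i j).
Proof.
rewrite (_ : (fun t => _) = (fun u : p.-tuple R => tnth u j)
    \o (fun t : n.-tuple (p.-tuple R) => tnth t i)).
  by apply: measurableT_comp; exact: measurable_tnth.
by apply/funext => t; rewrite mxE.
Qed.

Lemma quadratic_formE (R : comPzRingType) (p : nat) (M : 'M[R]_p) (e : 'cV[R]_p) :
  (e^T *m M *m e) 0 0 = \sum_j \sum_l M j l * (e j 0 * e l 0).
Proof.
rewrite mxE exchange_big /=; apply: eq_bigr => l _.
rewrite mxE mulr_suml; apply: eq_bigr => j _.
by rewrite mxE mulrCA mulrA.
Qed.

Section ConditionalRisk.
Local Open Scope ereal_scope.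
Context d d1 (T : measurableType d) (T1 : measurableType d1) (R : realType).
Context (P : probability T R) (n p B : nat).
Variables (rows : 'I_B -> 'I_(n %/ B) -> 'I_n) (a : R) (e0 : 'cV[R]_p) (k : nat).
Variables (Z : 'I_n -> T -> T1) (phi : 'I_n -> T1 -> p.-tuple R) (psi : 'I_n -> T1 -> R).
Variables (x0 : T -> p.-tuple R) (Sigma : 'M[R]_p) (sigma : R).
Hypothesis mZ : forall i, measurable_fun setT (Z i).
Hypothesis mphi : forall i, measurable_fun setT (phi i).
Hypothesis mpsi : forall i, measurable_fun setT (psi i).
Hypothesis mx0 : measurable_fun setT x0.
Hypothesis Zindep : mutually_independent P Z.
Hypothesis psi_sqr : forall i,
  P.-integrable setT (EFin \o (fun w => psi i (Z i w) ^+ 2)%R).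
Hypothesis psi_mean : forall i A, measurable A ->
  \int[P]_w (\1_A (phi i (Z i w)) * psi i (Z i w))%:E = 0.
Hypothesis psi_var : forall i A, measurable A ->
  \int[P]_w (\1_A (phi i (Z i w)) * psi i (Z i w) ^+ 2)%:E
  = \int[P]_w (\1_A (phi i (Z i w)) * sigma ^+ 2)%:E.
Hypothesis x0_indep : independent P x0 (fun w => [tuple Z i w | i < n]).
Hypothesis x0_cov : forall j l,
  \int[P]_w (tnth (x0 w) j * tnth (x0 w) l)%:E = (Sigma j l)%:E.

Let zeta o w := error_coef (fun i => psi i (Z i w)) o.
Let feat w := [tuple phi i (Z i w) | i < n].
Let mode o j (t : n.-tuple (p.-tuple R)) := error_mode rows a e0 k (features_mx t) o j 0%R.
Let err w := mean_iterate rows a (features_mx (feat w)) (\col_i psi i (Z i w)) e0 k.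

(* On these sets, which exhaust the feature space, the weights of the noise
   moments are bounded; without truncation they need not be integrable. *)
Definition bounded_modes (N : R) : set (n.-tuple (p.-tuple R)) :=
  [set t | forall oj : option 'I_n * 'I_p, (`|mode oj.1 oj.2 t| <= N)%R].

Lemma measurable_mode o j : measurable_fun setT (mode o j).
Proof.
have mi y v : measurable_fun setT (fun t : n.-tuple (p.-tuple R) =>
    mean_iterate rows a (features_mx t) y v k j 0%R).
  exact: (measurable_mean_iterate rows a (@measurable_features_mx R n p)
    (fun i => measurable_cst (y i 0%R)) k (fun i => measurable_cst (v i 0%R)) j).
by rewrite /mode; case: o => [i|]; exact: mi.
Qed.

Lemma measurable_bounded_modes N : measurable (bounded_modes N).
Proof.
rewrite (_ : bounded_modes N = \bigcap_(oj in [set: option 'I_n * 'I_p])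
    ((fun t => `|mode oj.1 oj.2 t|%R) @^-1` [set u | u <= N]%R)).
  apply: fin_bigcap_measurable => // oj _.
  apply: measurable_preimage_setT; last by rewrite -set_itvNyc; exact: measurable_itv.
  exact: measurableT_comp (measurable_mode _ _).
by apply/seteqP; split=> [t tN oj _|t tN oj]; exact: tN.
Qed.

Let VV j l w := (tnth (x0 w) j * tnth (x0 w) l)%R.

Let mx0j j : measurable_fun setT (fun w => tnth (x0 w) j).
Proof. exact: (measurableT_comp (measurable_tnth j) mx0). Qed.

Let VV_int j l : P.-integrable setT (EFin \o VV j l).
Proof.
have sq i : P.-integrable setT (EFin \o (fun w => tnth (x0 w) i ^+ 2)%R).
  apply/integrableP; split; first by apply/measurable_EFinP; exact: measurable_funX.
  under eq_integral => w _ do rewrite /= ger0_norm ?sqr_ge0 // expr2.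
  by rewrite x0_cov ltry.
exact: real_integrableM.
Qed.

Let mode_weight A o1 o2 j l t : R := (\1_A t * mode o1 j t * mode o2 l t)%R.

Let measurable_mode_weight A o1 o2 j l :
  measurable A -> measurable_fun setT (mode_weight A o1 o2 j l).
Proof.
move=> mA; apply: measurable_funM; last exact: measurable_mode.
by apply: measurable_funM; [exact: measurable_indic|exact: measurable_mode].
Qed.

Let mode_weight_bounded A N o1 o2 j l t : A `<=` bounded_modes N ->
  (`|mode_weight A o1 o2 j l t| <= N ^+ 2)%R.
Proof.
move=> AN; rewrite /mode_weight indicE; have [tA|tA] := boolP (t \in A); last first.
  by rewrite !mul0r normr0 sqr_ge0.
have tN := AN _ (set_mem tA).
by rewrite mul1r normrM expr2 ler_pM // ?(tN (o1, j)) ?(tN (o2, l)).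
Qed.

Let weight_int A N o1 o2 j l (f : T -> R) : measurable A -> A `<=` bounded_modes N ->
  P.-integrable setT (EFin \o f) ->
  P.-integrable setT (EFin \o (fun w => mode_weight A o1 o2 j l (feat w) * f w)%R).
Proof.
move=> mA AN fi; apply: (le_real_integrable _ _ (real_integrableZ (N ^+ 2) fi)).
  apply: measurable_funM; last exact: measurable_real_integrable fi.
  exact: measurableT_comp (measurable_mode_weight _ _ _ _ mA) (measurable_feat mZ mphi).
move=> w; rewrite [leLHS]normrM [leRHS]normrM ler_wpM2r //.
rewrite [leRHS]ger0_norm ?sqr_ge0 //.
exact: mode_weight_bounded.
Qed.

(** The new feature vector is independent of the whole sample, so its second moment factors out.
    What remains is a bounded function of the features times a product of coefficients, which may be
    replaced by its conditional mean [error_cov]. *)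
Let moment_term A N o1 o2 j l : measurable A -> A `<=` bounded_modes N ->
  let t w := (VV j l w * (mode_weight A o1 o2 j l (feat w) * (zeta o1 w * zeta o2 w)))%R in
  P.-integrable setT (EFin \o t) /\
  \int[P]_w (t w)%:E
  = \int[P]_w (Sigma j l * (error_cov sigma o1 o2 * mode_weight A o1 o2 j l (feat w)))%:E.
Proof.
move=> mA AN t.
have zi := integrable_error_coefM mZ mpsi psi_sqr o1 o2.
have wzi := weight_int o1 o2 j l mA AN zi.
have wi := weight_int o1 o2 j l mA AN (real_integrable_cst P 1%R).
(* The weighted product of coefficients as a function of the sample tuple, the form to which the
   independence from [x0] applies. *)
pose W (z : n.-tuple T1) : R :=
  (mode_weight A o1 o2 j l [tuple phi i (tnth z i) | i < n]
   * (error_coef (fun i => psi i (tnth z i)) o1 * error_coef (fun i => psi i (tnth z i)) o2))%R.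
have coefE o w : error_coef (fun i => psi i (tnth [tuple Z i w | i < n] i)) o = zeta o w.
  by case: o => [i|] //=; rewrite tnth_mktuple.
have WE w : W [tuple Z i w | i < n]
    = (mode_weight A o1 o2 j l (feat w) * (zeta o1 w * zeta o2 w))%R.
  rewrite /W !coefE; congr (mode_weight _ _ _ _ _ _ * _)%R.
  by apply: eq_from_tnth => i; rewrite !tnth_mktuple.
have mW : measurable_fun setT W.
  have mc o : measurable_fun setT (fun z : n.-tuple T1 => error_coef (fun i => psi i (tnth z i)) o).
    case: o => [i|] /=; last exact: measurable_cst.
    exact: (measurableT_comp (mpsi i) (measurable_tnth i)).
  apply: measurable_funM; last exact: measurable_funM.
  apply: (measurableT_comp (measurable_mode_weight o1 o2 j l mA)).
  exact: (@measurable_feat _ _ _ _ _ _ _ (fun i (z : n.-tuple T1) => tnth z i) phi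
    (fun i => measurable_tnth i) mphi).
have mZt : measurable_fun setT (fun w => [tuple Z i w | i < n]).
  exact: (measurable_feat mZ (fun i => @measurable_id _ _ _)).
have mVV : measurable_fun setT (fun u : p.-tuple R => tnth u j * tnth u l)%R.
  by apply: measurable_funM; exact: measurable_tnth.
have Wi : P.-integrable setT (EFin \o (W \o (fun w => [tuple Z i w | i < n]))).
  by apply: eq_real_integrable wzi => w /=; rewrite WE.
have [ti tE] := indep_product_integral mx0 mZt x0_indep mVV mW (VV_int j l) Wi.
split; first by apply: eq_real_integrable ti => w; rewrite WE.
have -> : \int[P]_w (t w)%:E = (Sigma j l)%:E *
    \int[P]_w (mode_weight A o1 o2 j l (feat w) * (zeta o1 w * zeta o2 w))%:E.
  rewrite -x0_cov /t; under eq_integral => w _ do rewrite -WE.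
  by rewrite tE; congr (_ * _); apply: eq_integral => w _; rewrite WE.
rewrite real_integralZ; last first.
  by apply: real_integrableZ; apply: eq_real_integrable wi => w; rewrite mulr1.
congr (_ * _); pose f w := (zeta o1 w * zeta o2 w - error_cov sigma o1 o2)%R.
have fi : P.-integrable setT (EFin \o f).
  exact: real_integrableD zi (real_integrable_cst _ _).
have wfi := weight_int o1 o2 j l mA AN fi.
have cwi : P.-integrable setT
    (EFin \o (fun w => error_cov sigma o1 o2 * mode_weight A o1 o2 j l (feat w))%R).
  by apply: real_integrableZ; apply: eq_real_integrable wi => w; rewrite mulr1.
transitivity (\int[P]_w (mode_weight A o1 o2 j l (feat w) * f w
    + error_cov sigma o1 o2 * mode_weight A o1 o2 j l (feat w))%:E).
  by apply: eq_integral => w _; congr EFin; rewrite /f; ring.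
rewrite real_integralD // (integral_weight_eq0 (measurable_feat mZ mphi)) ?add0e //.
  exact: measurable_mode_weight.
by move=> D mD; exact: error_coef_cov.
Qed.

Let err_entry w : ((feature_vec (x0 w))^T *m err w) 0%R 0%R
  = (\sum_(jo : 'I_p * option 'I_n)
      tnth (x0 w) jo.1 * (zeta jo.2 w * mode jo.2 jo.1 (feat w)))%R.
Proof.
rewrite -(pair_bigA _ (fun j o => tnth (x0 w) j * (zeta o w * mode o j (feat w))))%R /=.
rewrite mxE; apply: eq_bigr => j _; rewrite -mulr_sumr.
rewrite [X in (X * _)%R]mxE [X in (X * _)%R]mxE; congr (_ * _)%R.
rewrite /err mean_iterate_modes summxE; apply: eq_bigr => o _.
by rewrite mxE; congr (_ * _)%R; case: o => [i|] //=; rewrite mxE.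
Qed.

(** Cross pairs of modes, for which [error_cov] vanishes, are included so that the sum matches the
    expanded square of [err_entry] term by term. *)
Let risk_entry t : conditional_risk rows a e0 k Sigma sigma (features_mx t)
  = (\sum_(q : ('I_p * option 'I_n) * ('I_p * option 'I_n))
      Sigma q.1.1 q.2.1 * (error_cov sigma q.1.2 q.2.2
                           * (mode q.1.2 q.1.1 t * mode q.2.2 q.2.1 t)))%R.
Proof.
pose G (q1 q2 : 'I_p * option 'I_n) := (Sigma q1.1 q2.1 * (error_cov sigma q1.2 q2.2
  * (mode q1.2 q1.1 t * mode q2.2 q2.1 t)))%R.
rewrite -(pair_bigA _ G) -(pair_bigA _ (fun j o => \sum_q2 G (j, o) q2))%R /=.
rewrite exchange_big; apply: eq_bigr => o _ /=.
rewrite quadratic_formE mulr_sumr; apply: eq_bigr => j _ /=; rewrite mulr_sumr.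
rewrite -(pair_bigA _ (fun l o' => G (j, o) (l, o')))%R /=; apply: eq_bigr => l _.
rewrite (bigD1 o) //= big1 ?addr0 => [|o' oo']; last first.
  by rewrite /G /error_cov /= eq_sym (negbTE oo') mul0r mulr0.
by rewrite /G /error_cov /= eqxx mulrCA.
Qed.

(** This is the defining identity of a conditional expectation, on feature events where the modes
    are bounded; each term of the expanded square is then integrable. *)
Lemma conditional_risk_moment A N : measurable A -> A `<=` bounded_modes N ->
  P.-integrable setT (EFin \o (fun w => \1_A (feat w)
     * conditional_risk rows a e0 k Sigma sigma (features_mx (feat w)))%R) /\
  \int[P]_w (\1_A (feat w) * (((feature_vec (x0 w))^T *m err w) 0%R 0%R) ^+ 2)%:E
  = \int[P]_w (\1_A (feat w)
     * conditional_risk rows a e0 k Sigma sigma (features_mx (feat w)))%:E.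
Proof.
move=> mA AN.
pose I : finType := (('I_p * option 'I_n) * ('I_p * option 'I_n))%type.
pose t (q : I) w := (VV q.1.1 q.2.1 w * (mode_weight A q.1.2 q.2.2 q.1.1 q.2.1 (feat w)
                      * (zeta q.1.2 w * zeta q.2.2 w)))%R.
pose r (q : I) w := (Sigma q.1.1 q.2.1 * (error_cov sigma q.1.2 q.2.2
                      * mode_weight A q.1.2 q.2.2 q.1.1 q.2.1 (feat w)))%R.
have lossE w : (\1_A (feat w) * (((feature_vec (x0 w))^T *m err w) 0%R 0%R) ^+ 2
    = \sum_q t q w)%R.
  rewrite err_entry expr2 big_distrlr /= pair_bigA mulr_sumr.
  by apply: eq_bigr => q _; rewrite /t /VV /mode_weight; ring.
have riskE w : (\1_A (feat w)
     * conditional_risk rows a e0 k Sigma sigma (features_mx (feat w))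
    = \sum_q r q w)%R.
  rewrite risk_entry mulr_sumr.
  by apply: eq_bigr => q _; rewrite /r /mode_weight; ring.
have ri q : P.-integrable setT (EFin \o r q).
  do 2 apply: real_integrableZ.
  have := weight_int q.1.2 q.2.2 q.1.1 q.2.1 mA AN (real_integrable_cst P 1%R).
  by apply: eq_real_integrable => w; rewrite mulr1.
have tP q := moment_term q.1.2 q.2.2 q.1.1 q.2.1 mA AN.
split.
  exact: eq_real_integrable (fun w => esym (riskE w)) (real_integrable_sum _ ri).
under eq_integral => w _ do rewrite lossE.
under [RHS]eq_integral => w _ do rewrite riskE.
rewrite !real_integral_sum //; last by move=> q; case: (tP q).
by apply: eq_bigr => q _; case: (tP q).
Qed.

End ConditionalRisk.

Lemma design_features d (T : measurableType d) (R : realType)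
    (P : probability T R) (n p : nat) (x : 'I_n -> {RV P >-> p.-tuple R}) w :
  design x w = features_mx (features x w).
Proof. by apply/matrixP => i j; rewrite !mxE tnth_mktuple. Qed.

(** There are finitely many modes, so an integer above the sum of their absolute values works. Hence
    countably many bounded sets cover the feature space. *)
Lemma finite_modes (R : realType) (n p B : nat)
    (rows : 'I_B -> 'I_(n %/ B) -> 'I_n) (a : R) (e0 : 'cV[R]_p) (k : nat)
    (t : n.-tuple (p.-tuple R)) :
  exists N : nat, bounded_modes rows a e0 k N%:R t.
Proof.
pose S := \sum_(oj : option 'I_n * 'I_p)
  `|error_mode rows a e0 k (features_mx t) oj.1 oj.2 0|.
exists (Num.truncn S).+1 => oj; apply: ltW; apply: le_lt_trans (truncnS_gt S).
by rewrite /S (bigD1 oj) //= lerDl sumr_ge0.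
Qed.

Section Distribution.
Local Open Scope ereal_scope.
Context d d1 (T : measurableType d) (T1 : measurableType d1) (R : realType).
Variables (P : probability T R) (X : {mfun T >-> T1}).

(* By convention the integral of any measurable function is the difference of
   the integrals of its positive and negative parts. *)
Lemma integral_distribution_in (D : set T1) (f : T1 -> \bar R) :
  measurable D -> measurable_fun setT f ->
  \int[distribution P X]_(t in D) f t = \int[P]_(w in X @^-1` D) f (X w).
Proof.
move=> mD mf; have mX : measurable_fun setT X by exact: measurable_funP.
rewrite integralE [RHS]integralE; congr (_ - _).
  rewrite (ge0_integral_pushforward mX) //; last exact/measurable_funTS/measurable_funepos.
  by apply: eq_integral => w _; rewrite /= !funeposE.
rewrite (ge0_integral_pushforward mX) //; last exact/measurable_funTS/measurable_funeneg.
by apply: eq_integral => w _; rewrite /= !funenegE.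
Qed.

Lemma ae_distribution (Q : T1 -> Prop) :
  {ae distribution P X, forall t, Q t} -> {ae P, forall w, Q (X w)}.
Proof.
move=> [N [mN N0 QN]]; exists (X @^-1` N); split => //.
- by apply: measurable_preimage_setT.
- by move=> w; exact: QN.
Qed.

End Distribution.

(** * Almost sure risk in the linear model *)

Section LinearModelRisk.
Local Open Scope ereal_scope.
Context d (T : measurableType d) (R : realType) (P : probability T R).
Context (n p B : nat) (rows : 'I_B -> 'I_(n %/ B) -> 'I_n) (a : R).
Context (beta0 betas : 'cV[R]_p) (k : nat) (Sigma : 'M[R]_p) (sigma : R).
Variables (x : 'I_n -> {RV P >-> p.-tuple R}) (y : 'I_n -> {RV P >-> R}).
Variables (x0 : {RV P >-> p.-tuple R}) (risk : n.-tuple (p.-tuple R) -> \bar R).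
Hypothesis n_gt0 : (0 < n)%N.
Hypothesis model : linear_model x y betas Sigma sigma.
Hypothesis fresh : fresh_feature x y x0.
Hypothesis riskP : is_generalization_error x betas x0
  (fun w => mean_iterate rows a (design x w) (response y w) beta0 k) risk.

Let psi (z : p.-tuple R * R) : R := (z.2 - \sum_j tnth z.1 j * betas j 0)%R.

Let noiseE i w : noise x y betas w i 0%R = psi (sample x y i w).
Proof.
by rewrite /noise /psi !mxE; congr (_ - _)%R; apply: eq_bigr => j _; rewrite mxE.
Qed.

Let mpsi : measurable_fun setT psi.
Proof.
apply: measurable_funB; first exact: measurable_snd.
apply: measurable_sum => j; apply: measurable_funM; last exact: measurable_cst.
exact: (measurableT_comp (measurable_tnth j) measurable_fst).
Qed.

Let msample i : measurable_fun setT (sample x y i).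
Proof. exact: measurable_fun_pair. Qed.

Let psi_sqr i : P.-integrable setT (EFin \o (fun w => psi (sample x y i w) ^+ 2)%R).
Proof.
have [_ _ _ /(_ setT measurableT)] := noise_variance model i.
rewrite preimage_setT => varE.
apply/integrableP; split.
  by apply/measurable_EFinP; apply: measurable_funX; exact: measurableT_comp.
under eq_integral => w _ do rewrite /= ger0_norm ?sqr_ge0 // -noiseE.
by rewrite varE real_integral_cst ltry.
Qed.

Let psi_mean i A : measurable A ->
  \int[P]_w (\1_A (x i w) * psi (sample x y i w))%:E = 0.
Proof.
move=> mA; have mxA : measurable (x i @^-1` A) by exact: measurable_preimage_setT.
have [_ _ _ /(_ A mA)] := noise_mean model i; rewrite integral0 => meanE.
rewrite -[RHS]meanE -real_integral_indicM //.
by apply: eq_integral => w _; rewrite noiseE.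
Qed.

Let psi_var i A : measurable A ->
  \int[P]_w (\1_A (x i w) * psi (sample x y i w) ^+ 2)%:E
  = \int[P]_w (\1_A (x i w) * sigma ^+ 2)%:E.
Proof.
move=> mA; have mxA : measurable (x i @^-1` A) by exact: measurable_preimage_setT.
have [_ _ _ /(_ A mA) varE] := noise_variance model i.
rewrite (real_integral_indicM P (fun=> sigma ^+ 2)%R mxA) -[RHS]varE.
rewrite -(real_integral_indicM P (fun w => noise x y betas w i 0%R ^+ 2)%R mxA).
by apply: eq_integral => w _; rewrite noiseE.
Qed.

(** The integral depends only on the law, which [x0] shares with the first sample; that sample
    exists since [n] is positive. *)
Let x0_cov j l : \int[P]_w (tnth (x0 w) j * tnth (x0 w) l)%:E = (Sigma j l)%:E.
Proof.
pose f (u : p.-tuple R) := (tnth u j * tnth u l)%R.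
have mf : measurable_fun setT f by apply: measurable_funM; exact: measurable_tnth.
have [_ law] := fresh; pose i := Ordinal n_gt0.
have distE (v : {RV P >-> p.-tuple R}) :
    \int[P]_w (f (v w))%:E = \int[distribution P v]_u (f u)%:E.
  rewrite (integral_distribution_in P v measurableT (f := EFin \o f)).
    by rewrite preimage_setT.
  exact/measurable_EFinP.
rewrite -(feature_covariance model i) unlock.
rewrite -[LHS]/(\int[P]_w (f (x0 w))%:E) -[RHS]/(\int[P]_w (f (x i w))%:E) !distE.
by apply: eq_measure_integral => A mA _; exact: law.
Qed.

(** On each set of bounded modes, [risk] and the conditional risk have the same integral over every
    measurable subset under the law of the features, so they agree there almost surely. The
    countable cover by these sets gives the claim. *)
Lemma generalization_error_ae :
  {ae P, forall w, risk (features x w)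
    = (conditional_risk rows a (beta0 - betas) k Sigma sigma (design x w))%:E}.
Proof.
have mF : measurable_fun setT (features x).
  exact: (measurable_feat (fun i => measurable_funP (x i)) (fun=> @measurable_id _ _ _)).
pose F : {mfun T >-> n.-tuple (p.-tuple R)} :=
  HB.pack (features x) (isMeasurableFun.Build _ _ _ _ _ mF).
pose h (t : n.-tuple (p.-tuple R)) :=
  conditional_risk rows a (beta0 - betas)%R k Sigma sigma (features_mx t).
pose bnd (N : nat) := bounded_modes rows a (beta0 - betas)%R k N%:R.
have mbnd N : measurable (bnd N) by exact: measurable_bounded_modes.
have mh : measurable_fun setT h.
  apply: measurable_sum => o; apply: measurable_funM => //.
  under eq_fun => t do rewrite quadratic_formE.
  apply: measurable_sum => j; apply: measurable_sum => l.
  apply: measurable_funM => //.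
  by apply: measurable_funM; exact: measurable_mode.
have [indep_x0 _] := fresh.
have moment N A (mA : measurable A) (AN : A `<=` bnd N) :=
  @conditional_risk_moment _ _ _ _ _ P n p B rows a (beta0 - betas)%R k
    (sample x y) (fun=> fst) (fun=> psi) x0 Sigma sigma
    msample (fun=> measurable_fst) (fun=> mpsi) (measurable_funP x0)
    (samples_independent model) psi_sqr psi_mean psi_var indep_x0 x0_cov A N%:R mA AN.
have lossE w : ((feature_vec (x0 w))^T *m mean_iterate rows a (design x w) (response y w) beta0 k
      - (feature_vec (x0 w))^T *m betas
    = (feature_vec (x0 w))^T *m mean_iterate rows a (features_mx (features x w))
        (\col_i psi (sample x y i w)) (beta0 - betas) k)%R.
  rewrite -mulmxBr -design_features -(mean_iterate_error rows a _ betas _ beta0 k).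
  suff <- : response y w = (design x w *m betas + \col_i psi (sample x y i w))%R by [].
  apply/matrixP => i j; rewrite ord1 [RHS]mxE [X in (_ + X)%R]mxE -noiseE.
  by rewrite /noise [X in (_ + X)%R]mxE [X in (_ + (_ + X))%R]mxE addrC subrK.
have [mY _ mrisk riskE] := riskP.
have ae_bnd N : {ae P, forall w, bnd N (features x w) ->
    (h (features x w))%:E = risk (features x w)}.
  apply: (@ae_distribution _ _ _ _ _ P F (fun t => bnd N t -> (h t)%:E = risk t)).
  have [ih _] := moment N _ (mbnd N) (@subset_refl _ _).
  apply: (@integral_ae_eq _ _ _ (distribution P F) (bnd N) (mbnd N) risk (EFin \o h)).
  - apply: (integrable_pushforward (phi := F)) => //.
    + exact/measurable_EFinP.
    + rewrite integrable_mkcond; last exact: measurable_preimage_setT.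
      apply: eq_integrable ih => // w _.
      by rewrite epatch_indic [in LHS]/= [in RHS]/= EFinM muleC.
  - exact: measurable_funTS.
  move=> A AN mA; have mFA : measurable (features x @^-1` A) by exact: measurable_preimage_setT.
  rewrite !integral_distribution_in //; last exact/measurable_EFinP.
  rewrite -[RHS]riskE // -real_integral_indicM // -[RHS]real_integral_indicM //.
  have [_ <-] := moment N A mA AN.
  by apply: eq_integral => w _; rewrite lossE.
apply: (filterS _ (ae_foralln ae_bnd)) => w /= eqw.
rewrite design_features; have [N tN] := finite_modes rows a (beta0 - betas)%R k (features x w).
by rewrite -(eqw N tN).
Qed.

End LinearModelRisk.

(** * Risk for a single fixed design *)

Section ConditionalModelRisk.
Local Open Scope ereal_scope.
Context d (T : measurableType d) (R : realType) (P : probability T R).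
Context (n p B : nat) (rows : 'I_B -> 'I_(n %/ B) -> 'I_n) (a : R).
Variables (beta0 betas : 'cV[R]_p) (k : nat) (Sigma : 'M[R]_p) (sigma : R).
Variables (x0 : {RV P >-> p.-tuple R}) (eta : 'I_n -> {RV P >-> R}).
Hypothesis model : conditional_model x0 eta Sigma sigma.

(** With constant features, one set of bounded modes contains the only feature value, its indicator
    is identically 1, and [conditional_risk_moment] becomes an identity between plain
    expectations. *)
Lemma conditional_model_risk (X : 'M[R]_(n, p)) :
  let beta w := mean_iterate rows a X (X *m betas + \col_i eta i w) beta0 k in
  'E_P[fun w => (((feature_vec (x0 w))^T *m beta w
                  - (feature_vec (x0 w))^T *m betas) 0%R 0%R ^+ 2)%R]
  = (conditional_risk rows a (beta0 - betas) k Sigma sigma X)%:E.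
Proof.
move=> beta; case: model => eta_indep eta_mean eta_var x0_indep x0_cov.
pose phi (i : 'I_n) (_ : R) := [tuple X i j | j < p].
have XE w : features_mx [tuple phi i (eta i w) | i < n] = X.
  by apply/matrixP => i j; rewrite mxE !tnth_mktuple.
have eta_sqr i : P.-integrable setT (EFin \o (fun w => eta i w ^+ 2)%R).
  apply/integrableP; split; first by apply/measurable_EFinP; exact: measurable_funX.
  under eq_integral => w _ do rewrite /= ger0_norm ?sqr_ge0 //.
  by have := eta_var i; rewrite unlock => ->; rewrite ltry.
have eta_int i : P.-integrable setT (EFin \o eta i).
  apply: eq_real_integrable (real_integrableM (f := eta i) (g := cst 1%R) _ _ _ _) => //.
  - by move=> w; rewrite mulr1.
  - by apply: eq_real_integrable (real_integrable_cst P 1%R) => w; rewrite expr1n.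
have psi_mean i A : measurable A -> \int[P]_w (\1_A (phi i (eta i w)) * eta i w)%:E = 0.
  move=> mA; rewrite /phi (real_integralZ _ (eta_int i)).
  by have := eta_mean i; rewrite unlock => ->; rewrite mule0.
have psi_var i A : measurable A ->
    \int[P]_w (\1_A (phi i (eta i w)) * eta i w ^+ 2)%:E
    = \int[P]_w (\1_A (phi i (eta i w)) * sigma ^+ 2)%:E.
  move=> mA; rewrite /phi (real_integralZ _ (eta_sqr i)) real_integral_cst EFinM.
  by have := eta_var i; rewrite unlock => ->.
have x0_covE j l : \int[P]_w (tnth (x0 w) j * tnth (x0 w) l)%:E = (Sigma j l)%:E.
  by rewrite -x0_cov unlock.
pose t0 := [tuple phi i 0%R | i < n].
have [N tN] := finite_modes rows a (beta0 - betas)%R k t0.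
have mbnd := measurable_bounded_modes rows a (beta0 - betas)%R k (n := n) N%:R.
have [_] := @conditional_risk_moment _ _ _ _ _ P n p B rows a (beta0 - betas)%R k
  (fun i => eta i) phi (fun=> id) x0 Sigma sigma
  (fun i => measurable_funP (eta i)) (fun i => @measurable_cst _ _ _ _ _ _)
  (fun=> @measurable_id _ _ _) (measurable_funP x0) eta_indep eta_sqr psi_mean
  psi_var x0_indep x0_covE _ N%:R mbnd (@subset_refl _ _).
have indicE1 w : \1_(bounded_modes rows a (beta0 - betas)%R k N%:R)
    [tuple phi i (eta i w) | i < n] = 1%R :> R.
  by rewrite indicE mem_set.
under eq_integral => w _ do rewrite indicE1 mul1r XE.
under [X in _ = X -> _]eq_integral => w _ do rewrite indicE1 mul1r XE.
rewrite real_integral_cst => <-; rewrite unlock; apply: eq_integral => w _.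
by rewrite -mulmxBr /beta mean_iterate_error.
Qed.

End ConditionalModelRisk.

Theorem proposition3p14
  (R : realType) (n p' B : nat) :
  let p := p'.+1 in
  forall (n_gt0 : (0 < n)%N) (B_gt0 : (0 < B)%N) (B_dvd_n : (B %| n)%N)
    (rows : 'I_B -> 'I_(n %/ B) -> 'I_n) (rows_part : batch_partition rows)
    (alpha : R) (alpha_ge0 : 0 <= alpha) (beta0 betas : 'cV[R]_p)
    (Sigma : 'M[R]_p) (sigma : R) (k : nat),
  let beta_bar X y := mean_iterate rows (alpha / B%:R) X y beta0 k in
  let decay q l := 1 - alpha * l * (1 - q.[l]) in
  let risk_formula q (S : 'M[R]_(n, p)) (V : 'M[R]_p) :=
    let lambda i := (V^T *m Sigma *m V) i i in
    let hlambda i := hat_lambda S i in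
    \sum_(i < p) lambda i * decay q (hlambda i) ^+ (2 * k)
                 * (V^T *m (beta0 - betas)) i 0 ^+ 2
    + sigma ^+ 2 / n%:R
      * \sum_(i < p) lambda i / hlambda i
                     * (1 - decay q (hlambda i) ^+ k) ^+ 2 in
  [/\ (* coordinates of the error vector *)
      forall (X : 'M[R]_(n, p)) (y eta : 'cV[R]_n) q U S V,
        y = X *m betas + eta ->
        polynomial_reshuffling rows (alpha / B%:R) X q U S V ->
        forall i : 'I_p,
          let l := hat_lambda S i in
          (V^T *m (beta_bar X y - betas)) i 0
          = decay q l ^+ k * (V^T *m (beta0 - betas)) i 0
            + l^-1 * (1 - decay q l ^+ k)
              * (n%:R^-1 *: (S^T *m (U^T *m eta))) i 0,
      (* generalization error, as a conditional expectation given X *)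
      forall (d : measure_display) (T : measurableType d)
        (P : probability T R) (x : 'I_n -> {RV P >-> p.-tuple R})
        (y : 'I_n -> {RV P >-> R}) (x0 : {RV P >-> p.-tuple R})
        (risk : n.-tuple (p.-tuple R) -> \bar R),
        linear_model x y betas Sigma sigma ->
        fresh_feature x y x0 ->
        is_generalization_error x betas x0
          (fun w => beta_bar (design x w) (response y w)) risk ->
        {ae P, forall w, forall q U S V,
          polynomial_reshuffling rows (alpha / B%:R) (design x w) q U S V ->
          is_diag_mx (V^T *m Sigma *m V) ->
          risk (features x w) = (risk_formula q S V)%:E}
    & (* generalization error, as an expectation under the conditional law of
         the noise and of the new feature vector given one value of X *)
      forall (X : 'M[R]_(n, p)) q U S V
        (d : measure_display) (T : measurableType d) (P : probability T R)
        (x0 : {RV P >-> p.-tuple R}) (eta : 'I_n -> {RV P >-> R}),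
        conditional_model x0 eta Sigma sigma ->
        polynomial_reshuffling rows (alpha / B%:R) X q U S V ->
        is_diag_mx (V^T *m Sigma *m V) ->
        let beta w := beta_bar X (X *m betas + \col_i eta i w) in
        ('E_P[fun w => (((feature_vec (x0 w))^T *m beta w
                        - (feature_vec (x0 w))^T *m betas) 0%R 0%R ^+ 2)%R]
         = (risk_formula q S V)%:E)%E].
Proof.
move=> p n_gt0 B_gt0 B_dvd_n rows rowsP alpha alpha_ge0 beta0 betas Sigma sigma k.
move=> beta_bar decay risk_formula.
have riskE X q U S V : polynomial_reshuffling rows (alpha / B%:R) X q U S V ->
    is_diag_mx (V^T *m Sigma *m V) ->
    conditional_risk rows (alpha / B%:R) (beta0 - betas) k Sigma sigma X
    = risk_formula q S V.
  exact: conditional_risk_polynomial.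
split.
- move=> X y eta q U S V -> XP i l.
  rewrite /beta_bar mean_iterate_error.
  exact: (mean_iterate_coordinate n_gt0 B_gt0 rowsP XP eta (beta0 - betas) k i).
- move=> d T P x y x0 risk model fresh riskP.
  have := (generalization_error_ae n_gt0 model fresh riskP).
  (* The null set does not depend on the decomposition, so [q], [U], [S] and [V] may be chosen
     afterwards for each outcome. *)
  apply: filterS => w riskw q U S V XP Ldiag.
  by rewrite riskw (riskE _ _ _ _ _ XP Ldiag).
- move=> X q U S V d T P x0 eta model XP Ldiag beta.
  by rewrite -(riskE _ _ _ _ _ XP Ldiag); exact: conditional_model_risk.
Qed.
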